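(* For the diamond network with orthogonal broadcast links, bit-pipe capacities $C_1,C_2$, and discrete memoryless MAC $p(y|x_1,x_2)$, the capacity satisfies $$C^\diamond\le \max_{p(x_1,x_2)}\ \min_{p(u|y)}\ \max_{p(q|x_1,x_2)}\ \min\left\{\begin{array}{l} C_1+C_2,\\ C_1+I(X_2;Y|X_1Q),\\ C_2+I(X_1;Y|X_2Q),\\ I(X_1X_2;Y|Q),\\ C_1+C_2-I(X_1X_2;U|Q)+I(X_2;U|X_1Q)+I(X_1;U|X_2Q)\end{array}\right\},$$ where $U$ takes values in an arbitrary finite alphabet, $Q$ takes values in a finite alphabet, and all quantities are evaluated for the joint pmf $p(x_1,x_2)\,p(q|x_1,x_2)\,p(y|x_1,x_2)\,p(u|y)$. Moreover, it suffices to take $|\mathcal Q|\le|\mathcal X_1||\mathcal X_2|+3$ in the inner maximization.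
   Context: Diamond network with orthogonal broadcast component: a message $W$ uniformly distributed on $\{1,\dots,2^{nR}\}$ is encoded into $(V_1^n,V_2^n)$ with $H(V_1^n)\le nC_1$, $H(V_2^n)\le nC_2$; $V_i^n$ is delivered without error to relay $i$, which maps it to $X_i^n\in\mathcal X_i^n$. $(X_1^n,X_2^n)$ is sent over $n$ uses of a memoryless MAC $p(y|x_1,x_2)$ with finite alphabets, giving $Y^n$, from which a decoder forms $\hat W$. $R$ is achievable if $\Pr(\hat W\ne W)$ can be made arbitrarily small for some $n$; $C^\diamond$ is the supremum of achievable rates. Logarithms base 2. *)

(* Defs.v *)
From Stdlib Require Import Reals.
From mathcomp Require Import all_boot.
Set Implicit Arguments. Unset Strict Implicit. Unset Printing Implicit Defensive.
Local Open Scope R_scope.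

Definition rsum (T : finType) (F : T -> R) : R := \big[Rplus/0]_(t : T) F t.

Definition pmf (T : finType) (p : T -> R) : Prop :=
  (forall t, 0 <= p t) /\ rsum p = 1.

Definition log2 (x : R) : R := ln x / ln 2.
Definition xlogx (x : R) : R := if Rlt_dec 0 x then x * log2 x else 0.

Definition marg (T S : finType) (P : T -> R) (f : T -> S) (s : S) : R :=
  \big[Rplus/0]_(t : T | f t == s) P t.

Definition ent (T S : finType) (P : T -> R) (f : T -> S) : R :=
  - rsum (fun s => xlogx (marg P f s)).

Definition cmi (T A B C : finType) (P : T -> R)
  (a : T -> A) (b : T -> B) (c : T -> C) : R :=
  ent P (fun t => (a t, c t)) + ent P (fun t => (b t, c t))
  - ent P (fun t => (a t, b t, c t)) - ent P c.

Definition channel (X1 X2 Y : finType) (W : X1 -> X2 -> Y -> R) : Prop :=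
  forall x1 x2, pmf (W x1 x2).

Definition block_prob (X1 X2 Y : finType) (W : X1 -> X2 -> Y -> R) (n : nat)
  (x1 : {ffun 'I_n -> X1}) (x2 : {ffun 'I_n -> X2}) (y : {ffun 'I_n -> Y}) : R :=
  \big[Rmult/1]_(i : 'I_n) W (x1 i) (x2 i) (y i).

Definition unif (M : nat) (w : 'I_M) : R := / INR M.

(* average error probability of a code: encoder (f1,f2), relays (g1,g2),
   decoder d *)
Definition error_prob (X1 X2 Y : finType) (W : X1 -> X2 -> Y -> R) (n M : nat)
  (V1 V2 : finType) (f1 : 'I_M -> V1) (f2 : 'I_M -> V2)
  (g1 : V1 -> {ffun 'I_n -> X1}) (g2 : V2 -> {ffun 'I_n -> X2})
  (d : {ffun 'I_n -> Y} -> 'I_M) : R :=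
  / INR M * rsum (fun w : 'I_M =>
     rsum (fun y : {ffun 'I_n -> Y} =>
       if d y == w then 0 else block_prob W (g1 (f1 w)) (g2 (f2 w)) y)).

Definition achievable (X1 X2 Y : finType) (W : X1 -> X2 -> Y -> R)
  (C1 C2 Rt : R) : Prop :=
  forall eps, 0 < eps ->
  exists (n M : nat), (0 < n)%nat /\ Rpower 2 (INR n * Rt) <= INR M /\
  exists (V1 V2 : finType) (f1 : 'I_M -> V1) (f2 : 'I_M -> V2)
         (g1 : V1 -> {ffun 'I_n -> X1}) (g2 : V2 -> {ffun 'I_n -> X2})
         (d : {ffun 'I_n -> Y} -> 'I_M),
    ent (@unif M) f1 <= INR n * C1 /\
    ent (@unif M) f2 <= INR n * C2 /\
    error_prob W f1 f2 g1 g2 d < eps.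

Definition joint (X1 X2 Y Q U : finType) (W : X1 -> X2 -> Y -> R)
  (px : X1 * X2 -> R) (pq : X1 -> X2 -> Q -> R) (pu : Y -> U -> R)
  (o : X1 * X2 * Q * Y * U) : R :=
  let: ((((x1, x2), q), y), u) := o in
  px (x1, x2) * pq x1 x2 q * W x1 x2 y * pu y u.

Definition pX1 (X1 X2 Y Q U : finType) (o : X1 * X2 * Q * Y * U) : X1 := o.1.1.1.1.
Definition pX2 (X1 X2 Y Q U : finType) (o : X1 * X2 * Q * Y * U) : X2 := o.1.1.1.2.
Definition pX12 (X1 X2 Y Q U : finType) (o : X1 * X2 * Q * Y * U) : X1 * X2 := o.1.1.1.
Definition pQ (X1 X2 Y Q U : finType) (o : X1 * X2 * Q * Y * U) : Q := o.1.1.2.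
Definition pY (X1 X2 Y Q U : finType) (o : X1 * X2 * Q * Y * U) : Y := o.1.2.
Definition pU (X1 X2 Y Q U : finType) (o : X1 * X2 * Q * Y * U) : U := o.2.
Definition pX1Q (X1 X2 Y Q U : finType) (o : X1 * X2 * Q * Y * U) : X1 * Q :=
  (o.1.1.1.1, o.1.1.2).
Definition pX2Q (X1 X2 Y Q U : finType) (o : X1 * X2 * Q * Y * U) : X2 * Q :=
  (o.1.1.1.2, o.1.1.2).

Definition diamond_obj (X1 X2 Y Q U : finType) (W : X1 -> X2 -> Y -> R)
  (C1 C2 : R) (px : X1 * X2 -> R) (pq : X1 -> X2 -> Q -> R) (pu : Y -> U -> R) : R :=
  let P := joint W px pq pu in
  let iX2Y_X1Q := cmi P (@pX2 X1 X2 Y Q U) (@pY X1 X2 Y Q U) (@pX1Q X1 X2 Y Q U) in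
  let iX1Y_X2Q := cmi P (@pX1 X1 X2 Y Q U) (@pY X1 X2 Y Q U) (@pX2Q X1 X2 Y Q U) in
  let iX12Y_Q := cmi P (@pX12 X1 X2 Y Q U) (@pY X1 X2 Y Q U) (@pQ X1 X2 Y Q U) in
  let iX12U_Q := cmi P (@pX12 X1 X2 Y Q U) (@pU X1 X2 Y Q U) (@pQ X1 X2 Y Q U) in
  let iX2U_X1Q := cmi P (@pX2 X1 X2 Y Q U) (@pU X1 X2 Y Q U) (@pX1Q X1 X2 Y Q U) in
  let iX1U_X2Q := cmi P (@pX1 X1 X2 Y Q U) (@pU X1 X2 Y Q U) (@pX2Q X1 X2 Y Q U) in
  Rmin (C1 + C2)
  (Rmin (C1 + iX2Y_X1Q)
  (Rmin (C2 + iX1Y_X2Q)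
  (Rmin iX12Y_Q
        (C1 + C2 - iX12U_Q + iX2U_X1Q + iX1U_X2Q)))).

(* Main.v *)
(* The converse works letter by letter on a code of block length n, with messages w uniform on
   'I_M and a memoryless side channel p(u|y) appended to the output. Write S_i = (Y_i, U_i),
   let h_i be the entropy of S_i given (X_1i, X_2i), and put I = H(S^n) - sum_i h_i, the
   information carried by the pairs. Fano's inequality bounds (1 - error) log M by I up to a
   vanishing slack. Choosing Q_i = U^(i-1), the chain rule and "conditioning reduces entropy"
   bound I by each entry of the minimum. For the last entry,
   H(V_1) + H(V_2) - H(V_1,V_2) = I(V_1;V_2) >= I(V_1;V_2) - I(V_1;V_2|U^n), and the right side
   is a combination of entropies of U^n to which the chain rule applies. Working with the pairs
   S_i rather than with Y_i makes U^(i-1) a function of the past, so that no Markov relation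
   between blocks is ever needed. A uniform time index i is then absorbed into Q = (i, U^(i-1)).

   For the cardinality bound, every term is linear in nonnegative weights r(q) applied to the
   slices p(x1,x2,q). *)
Require Import Defs.
From Stdlib Require Import Reals Lra FunctionalExtensionality.
From mathcomp Require Import all_boot.
From mathcomp Require Import Rstruct.
Set Implicit Arguments. Unset Strict Implicit. Unset Printing Implicit Defensive.
Local Open Scope R_scope.

(** * Finite sums and logarithms *)

Lemma sumR_le (T : finType) (p : pred T) (F G : T -> R) :
  (forall t, p t -> F t <= G t) ->
  \big[Rplus/0]_(t | p t) F t <= \big[Rplus/0]_(t | p t) G t.
Proof. by move=> h; apply: (big_ind2 Rle) => // *; lra. Qed.

Lemma sumR_ge0 (T : finType) (p : pred T) (F : T -> R) :
  (forall t, p t -> 0 <= F t) -> 0 <= \big[Rplus/0]_(t | p t) F t.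
Proof. by move=> h; apply: (big_ind (fun x => 0 <= x)) => // *; lra. Qed.

Lemma sumR_ge_term (T : finType) (p : pred T) (F : T -> R) t0 :
  (forall t, p t -> 0 <= F t) -> p t0 -> F t0 <= \big[Rplus/0]_(t | p t) F t.
Proof.
move=> h pt; rewrite (bigD1 t0) //=.
have : 0 <= \big[Rplus/0]_(t | p t && (t != t0)) F t.
  by apply: sumR_ge0 => t /andP[/h].
lra.
Qed.

Lemma sumRN (T : finType) (p : pred T) (F : T -> R) :
  \big[Rplus/0]_(t | p t) - F t = - \big[Rplus/0]_(t | p t) F t.
Proof.
by rewrite (big_morph Ropp (id1 := 0) (op1 := Rplus)) //; [exact: Ropp_plus_distr | exact: Ropp_0].
Qed.

Lemma sumRB (T : finType) (p : pred T) (F G : T -> R) :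
  \big[Rplus/0]_(t | p t) (F t - G t) =
  \big[Rplus/0]_(t | p t) F t - \big[Rplus/0]_(t | p t) G t.
Proof. by rewrite /Rminus big_split sumRN. Qed.

Lemma sumR_const (T : finType) (c : R) :
  \big[Rplus/0]_(t : T) c = INR #|T| * c.
Proof.
rewrite big_const; elim: #|T| => [|k IH]; first by rewrite /=; lra.
by rewrite iterS IH S_INR; lra.
Qed.

Lemma INR_gt0 (k : nat) : (0 < k)%N -> 0 < INR k.
Proof. by move=> /ltP; apply: lt_0_INR. Qed.

Lemma prodR_ge0 (I : finType) (p : pred I) (F : I -> R) :
  (forall i, 0 <= F i) -> 0 <= \big[Rmult/1]_(i | p i) F i.
Proof.
move=> h; apply: (big_ind (fun x => 0 <= x)) => //; first lra.
by move=> *; apply: Rmult_le_pos.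
Qed.

Lemma log2_mul x y : 0 < x -> 0 < y -> log2 (x * y) = log2 x + log2 y.
Proof. by move=> *; rewrite /log2 ln_mult // /Rdiv Rmult_plus_distr_r. Qed.

Lemma log2_inv x : 0 < x -> log2 (/ x) = - log2 x.
Proof. by move=> *; rewrite /log2 ln_Rinv // /Rdiv; lra. Qed.

Lemma log2_1 : log2 1 = 0.
Proof. by rewrite /log2 ln_1 /Rdiv; lra. Qed.

Lemma ln2_gt0 : 0 < ln 2.
Proof. by rewrite -ln_1; apply: ln_increasing; lra. Qed.

Lemma log2_le x y : 0 < x -> x <= y -> log2 x <= log2 y.
Proof.
move=> x0 xy; have := ln2_gt0 => l2.
apply: Rmult_le_compat_r; first by apply/Rlt_le/Rinv_0_lt_compat.
by case: (Rle_lt_or_eq_dec _ _ xy) => [/(ln_increasing _ _ x0)|->]; lra.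
Qed.

Lemma ln_le_sub1 x : 0 < x -> ln x <= x - 1.
Proof. by move=> x0; have := exp_ineq1_le (ln x); rewrite exp_ln //; lra. Qed.

Lemma xlogxE x : 0 <= x -> xlogx x = x * log2 x.
Proof.
move=> x0; rewrite /xlogx; case: Rlt_dec => //= n0; have e : x = 0 by lra.
by rewrite e; lra.
Qed.

(** * Entropy *)

Section Marginals.
Variables (T : finType) (P : T -> R).
Hypothesis P0 : forall t, 0 <= P t.

Lemma marg_ge0 (S : finType) (f : T -> S) s : 0 <= marg P f s.
Proof. by apply: sumR_ge0. Qed.

Lemma marg_gt0 (S : finType) (f : T -> S) t : 0 < P t -> 0 < marg P f (f t).
Proof.
move=> Pt; apply: (Rlt_le_trans _ _ _ Pt).
by apply: (@sumR_ge_term _ (fun t' => f t' == f t)).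
Qed.

Lemma sum_marg (S : finType) (f : T -> S) (G : S -> R) :
  \big[Rplus/0]_s (marg P f s * G s) = \big[Rplus/0]_t (P t * G (f t)).
Proof.
rewrite (partition_big f xpredT) //=; apply: eq_bigr => s _.
by rewrite /marg big_distrl /=; apply: eq_bigr => t /eqP ->.
Qed.

Lemma entE (S : finType) (f : T -> S) :
  ent P f = - \big[Rplus/0]_t (P t * log2 (marg P f (f t))).
Proof.
rewrite -(sum_marg f (fun s => log2 (marg P f s))); congr (- _).
by apply: eq_bigr => s _; rewrite xlogxE //; apply: marg_ge0.
Qed.

Lemma eq_ent (S S' : finType) (f : T -> S) (g : T -> S') :
  (forall t t', (f t == f t') = (g t == g t')) -> ent P f = ent P g.
Proof.
move=> h; rewrite !entE; congr (- _); apply: eq_bigr => t _.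
by congr (_ * log2 _); apply: eq_bigl => t'; rewrite h.
Qed.

Lemma marg_marg (S S' : finType) (f : T -> S) (g : S -> S') s :
  marg (marg P f) g s = marg P (fun t => g (f t)) s.
Proof.
rewrite /marg [RHS](partition_big f (fun x => g x == s)) //=.
by apply: eq_bigr => x /eqP gx; apply: eq_bigl => t; case: eqP => [->|]; rewrite ?gx ?eqxx ?andbT ?andbF.
Qed.

Lemma ent_marg (S S' : finType) (f : T -> S) (g : S -> S') :
  ent (marg P f) g = ent P (fun t => g (f t)).
Proof. by congr (- _); apply: eq_bigr => s _; rewrite marg_marg. Qed.

(** Jensen's inequality in the form [ln x <= x - 1], applied to the ratio of [q] to the true
    marginal. A subprobability [q] that is positive on the support suffices, which lets later uses
    pick unnormalized or partly vanishing guesses. *)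
Lemma gibbs (S : finType) (f : T -> S) (q : S -> R) :
  rsum P = 1 -> (forall s, 0 <= q s) -> \big[Rplus/0]_s q s <= 1 ->
  (forall t, 0 < P t -> 0 < q (f t)) ->
  ent P f <= - \big[Rplus/0]_t (P t * log2 (q (f t))).
Proof.
move=> P1 q0 q1 qpos; have l2 := ln2_gt0.
rewrite entE; apply: Ropp_le_contravar.
suff : \big[Rplus/0]_t (P t * log2 (q (f t))
          - P t * log2 (marg P f (f t))) <= 0 by rewrite sumRB; lra.
have step t : P t * log2 (q (f t)) - P t * log2 (marg P f (f t)) <=
    (P t * (q (f t) / marg P f (f t)) - P t) * / ln 2.
  case: (Rle_lt_or_eq_dec _ _ (P0 t)) => [Pt|<-]; last by lra.
  have m0 := marg_gt0 f Pt; have qt := qpos _ Pt.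
  have := ln_le_sub1 (Rmult_lt_0_compat _ _ qt (Rinv_0_lt_compat _ m0)).
  rewrite ln_mult // ?ln_Rinv //; last exact: Rinv_0_lt_compat.
  have i2 := Rinv_0_lt_compat _ l2 => h.
  rewrite /log2 /Rdiv.
  have -> : P t * (ln (q (f t)) * / ln 2) - P t * (ln (marg P f (f t)) * / ln 2) =
    (P t * (ln (q (f t)) - ln (marg P f (f t)))) * / ln 2 by ring.
  apply: Rmult_le_compat_r; first lra.
  have -> : P t * (q (f t) * / marg P f (f t)) - P t =
    P t * (q (f t) * / marg P f (f t) - 1) by ring.
  by apply: Rmult_le_compat_l; lra.
apply: (Rle_trans _ _ _ (sumR_le (fun t _ => step t))).
rewrite -big_distrl /= sumRB.
rewrite -(sum_marg f (fun s => q s / marg P f s)).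
have h : \big[Rplus/0]_s (marg P f s * (q s / marg P f s)) <= \big[Rplus/0]_s q s.
  apply: sumR_le => s _; case: (Rle_lt_or_eq_dec _ _ (marg_ge0 f s)) => [m0|<-].
    by apply: Req_le; field; lra.
  by rewrite Rmult_0_l.
rewrite -/(rsum P) P1.
have := Rinv_0_lt_compat _ l2 => i2.
apply: (Rle_trans _ (0 * / ln 2)); last lra.
apply: Rmult_le_compat_r; lra.
Qed.

(** The conditional entropy H(a | c). *)
Definition cent (A C : finType) (a : T -> A) (c : T -> C) : R :=
  ent P (fun t => (a t, c t)) - ent P c.

Lemma cmi_cent (A B C : finType) (a : T -> A) (b : T -> B) (c : T -> C) :
  cmi P a b c = cent b c - cent b (fun t => (a t, c t)).
Proof.
have e : ent P (fun t => (a t, b t, c t)) = ent P (fun t => (b t, (a t, c t))).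
  by apply: eq_ent => t t'; rewrite !xpair_eqE; case: (a t == _); case: (b t == _).
by rewrite /cmi /cent /= e; lra.
Qed.

Lemma marg_pair_fst (A B : finType) (a : T -> A) (b : T -> B) x :
  \big[Rplus/0]_y marg P (fun t => (a t, b t)) (x, y) = marg P a x.
Proof.
by rewrite /marg [RHS](partition_big b xpredT).
Qed.

Lemma marg_pair_snd (A B : finType) (a : T -> A) (b : T -> B) y :
  \big[Rplus/0]_x marg P (fun t => (a t, b t)) (x, y) = marg P b y.
Proof.
rewrite /marg [RHS](partition_big a xpredT) //=; apply: eq_bigr => x _.
by apply: eq_bigl => t; rewrite xpair_eqE andbC.
Qed.

Lemma sum_margT (S : finType) (f : T -> S) : rsum (marg P f) = rsum P.
Proof. by rewrite /rsum [RHS](partition_big f xpredT). Qed.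

(** Gibbs' inequality against the law p(a,c) p(b,c) / p(c), under which [a] and [b] are
    conditionally independent given [c]. Where p(c) = 0 the inverse is 0, so the guess vanishes
    there. *)
Lemma cmi_ge0 (A B C : finType) (a : T -> A) (b : T -> B) (c : T -> C) :
  rsum P = 1 -> 0 <= cmi P a b c.
Proof.
move=> P1.
pose mac := marg P (fun t => (a t, c t)); pose mbc := marg P (fun t => (b t, c t)).
pose q (x : A * B * C) := mac (x.1.1, x.2) * mbc (x.1.2, x.2) * / marg P c x.2.
have q0 x : 0 <= q x.
  have [m0|m0] := Rle_lt_or_eq_dec _ _ (marg_ge0 c x.2).
    have := Rinv_0_lt_compat _ m0 => i0.
    by do 2?apply: Rmult_le_pos; rewrite ?/mac ?/mbc; try exact: marg_ge0; lra.
  by rewrite /q -m0 Rinv_0; lra.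
have h : ent P (fun t => (a t, b t, c t)) <=
    - \big[Rplus/0]_t (P t * log2 (q (a t, b t, c t))).
  apply: (gibbs P1 q0).
  - rewrite -(pair_bigA _ (fun ab z => q (ab, z))) exchange_big /=.
    rewrite -P1 -(sum_margT c); apply: sumR_le => z _.
    rewrite -(pair_bigA _ (fun x y => q (x, y, z))) /= /q /=.
    under eq_bigr => x _ do rewrite -big_distrl -big_distrr /= /mbc marg_pair_snd.
    rewrite -!big_distrl /= /mac marg_pair_snd.
    have [m0|<-] := Rle_lt_or_eq_dec _ _ (marg_ge0 c z); last by rewrite Rinv_0; lra.
    by apply: Req_le; field; lra.
  - move=> t Pt; rewrite /q /=.
    by do 2?apply: Rmult_lt_0_compat; try apply: Rinv_0_lt_compat; rewrite ?/mac ?/mbc;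
    apply: (marg_gt0 _ Pt).
rewrite /cmi.
suff : (- \big[Rplus/0]_t (P t * log2 (q (a t, b t, c t)))) =
     ent P (fun t => (a t, c t)) + ent P (fun t => (b t, c t)) - ent P c by lra.
  rewrite !entE -!sumRN -big_split -sumRB; apply: eq_bigr => t _ /=.
  have [Pt|<-] := Rle_lt_or_eq_dec _ _ (P0 t); last by lra.
  have h1 : 0 < mac (a t, c t) by apply: (marg_gt0 (fun t => (a t, c t)) Pt).
  have h2 : 0 < mbc (b t, c t) by apply: (marg_gt0 (fun t => (b t, c t)) Pt).
  have h3 := marg_gt0 c Pt.
  rewrite /q /= !log2_mul ?log2_inv ?/mac ?/mbc //; try lra.
  - exact: Rmult_lt_0_compat.
  - exact: Rinv_0_lt_compat.
Qed.

(** Conditioning reduces entropy: the gap is I(c'; a | c). That [c] is a function of [c'] is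
    expressed by inclusion of fibers, so no such function has to be exhibited. *)
Lemma cent_le (A C C' : finType) (a : T -> A) (c : T -> C) (c' : T -> C') :
  rsum P = 1 -> (forall t t', c' t = c' t' -> c t = c t') -> cent a c' <= cent a c.
Proof.
move=> P1 h; have := cmi_ge0 c' a c P1; rewrite cmi_cent.
have e t t' : ((c' t, c t) == (c' t', c t')) = (c' t == c' t').
  by rewrite xpair_eqE; case: eqP => // /h ->; rewrite eqxx.
suff -> : cent a (fun t => (c' t, c t)) = cent a c' by lra.
by congr (_ - _); apply: eq_ent => t t'; rewrite ?e // xpair_eqE e xpair_eqE.
Qed.

(** [K] is a conditional law of [a] given [z]; the product form avoids dividing by the mass of null
    values of [z]. *)
Definition transition (A Z : finType) (a : T -> A) (z : T -> Z) (K : Z -> A -> R) :=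
  forall v x, marg P (fun t => (a t, z t)) (x, v) = marg P z v * K v x.

(** The logarithm of marginal times kernel splits, and the part from the marginal is the entropy of
    [z]. The remaining average runs over [t], so two conditionings that yield the same kernel rows
    yield literally the same sum. *)
Lemma cent_transition (A Z : finType) (a : T -> A) (z : T -> Z) K :
  (forall v, pmf (K v)) -> transition a z K ->
  cent a z = \big[Rplus/0]_t (P t * - rsum (fun x => xlogx (K (z t) x))).
Proof.
move=> Kp tr; rewrite -(sum_marg z (fun v => - rsum (fun x => xlogx (K v x)))).
rewrite /cent /ent /rsum -[X in - X - _](pair_bigA _ (fun x v =>
  xlogx (marg P (fun t => (a t, z t)) (x, v)))) exchange_big /=.
rewrite -!sumRN -sumRB; apply: eq_bigr => v _.
have m0 := marg_ge0 z v.
rewrite (xlogxE m0).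
under eq_bigr => x _.
  rewrite tr.
  have -> : xlogx (marg P z v * K v x) =
    (marg P z v * log2 (marg P z v)) * K v x
    + marg P z v * xlogx (K v x).
    have [k0 _] := Kp v; rewrite !xlogxE //; last by apply: Rmult_le_pos.
    case: (Rle_lt_or_eq_dec _ _ m0) => [m1|<-]; last lra.
    case: (Rle_lt_or_eq_dec _ _ (k0 x)) => [k1|<-]; last lra.
    by rewrite log2_mul //; lra.
  over.
rewrite big_split /= -!big_distrr /=.
by have [_] := Kp v; rewrite /rsum => ->; lra.
Qed.

End Marginals.

(** The coarser function has the larger marginal at every point, and the logarithm is monotone. *)
Lemma ent_le (T : finType) (P : T -> R) (S S' : finType) (f : T -> S) (g : T -> S') :
  (forall t, 0 <= P t) -> (forall t t', f t = f t' -> g t = g t') -> ent P g <= ent P f.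
Proof.
move=> P0 h; rewrite !entE //; apply/Ropp_le_contravar/sumR_le => t _.
have [Pt|<-] := Rle_lt_or_eq_dec _ _ (P0 t); last lra.
apply: Rmult_le_compat_l; first lra.
apply: log2_le; first by apply: (marg_gt0 _ f).
rewrite /marg big_mkcond [X in _ <= X]big_mkcond; apply: sumR_le => t' _.
by case: eqP => [/h ->|_]; rewrite ?eqxx; [lra | case: ifP => _; [exact: P0 | lra]].
Qed.

Lemma ent_unit (T : finType) (P : T -> R) : rsum P = 1 -> ent P (fun=> tt) = 0.
Proof.
move=> P1; rewrite /ent /rsum (big_pred1 tt); last by case.
have -> : marg P (fun=> tt) tt = 1 by rewrite -P1; apply: eq_bigl.
by rewrite xlogxE ?log2_1; lra.
Qed.

Lemma ent_pair_le (T : finType) (P : T -> R) (A B : finType) (a : T -> A) (b : T -> B) :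
  pmf P -> ent P (fun t => (a t, b t)) <= ent P a + ent P b.
Proof.
move=> [P0 P1]; have := cmi_ge0 P0 a b (fun=> tt) P1.
rewrite /cmi ent_unit // (@eq_ent _ _ P0 _ _ _ a) ?(@eq_ent _ _ P0 _ _ (fun t => (b t, tt)) b)
  ?(@eq_ent _ _ P0 _ _ (fun t => (a t, b t, tt)) (fun t => (a t, b t))); try lra.
all: by move=> t t'; rewrite !xpair_eqE andbT.
Qed.

Lemma pmf_marg (T S : finType) (P : T -> R) (f : T -> S) : pmf P -> pmf (marg P f).
Proof. by move=> [P0 P1]; split; [apply: marg_ge0 | rewrite sum_margT]. Qed.

(** The slack beyond the term in [err] depends on [delta] alone, hence neither on the number of
    messages nor on the block length. *)
Lemma fano (T A S : finType) (P : T -> R) (a : T -> A) (s : T -> S) (dec : S -> A) (delta : R) :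
  pmf P -> 0 < delta < 1 ->
  let err := \big[Rplus/0]_(t | dec (s t) != a t) P t in
  err <= delta ->
  cent P a s <= err * log2 (INR #|A|) - log2 (1 - delta) - delta * log2 delta.
Proof.
move=> [P0 P1] dl err errd.
have N0 : 0 < INR #|A|.
  have [t _|T0] := pickP (@predT T); last by move: P1; rewrite /rsum big_pred0 //; lra.
  by apply/INR_gt0/card_gt0P; exists (a t).
have dN : 0 < delta / INR #|A| by apply: Rdiv_lt_0_compat; lra.
(* Gibbs' inequality against the guess that trusts the decoder with probability
   [1 - delta] and is uniform otherwise; this yields a slack independent of [err]. *)
pose k (x : A * S) := (if dec x.2 == x.1 then 1 - delta else 0) + delta / INR #|A|.
have k0 x : 0 < k x by rewrite /k; case: ifP => _; lra.
pose q (x : A * S) := marg P s x.2 * k x.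
have q0 x : 0 <= q x by apply: Rmult_le_pos; [exact: marg_ge0 | exact: Rlt_le].
have q1 : \big[Rplus/0]_x q x <= 1.
  rewrite -(pair_bigA _ (fun y z => q (y, z))) exchange_big /=.
  rewrite -P1 -(sum_margT P s) /rsum; apply: sumR_le => z _; rewrite /q /k /= -big_distrr /=.
  rewrite big_split /= -big_mkcond /= (big_pred1 (dec z)); last by move=> y; rewrite eq_sym.
  rewrite sumR_const; apply: Req_le.
  by move: (INR #|A|) N0 (marg P s z) => N N0 m; field; lra.
have g := gibbs (f := fun t => (a t, s t)) P0 P1 q0 q1.
have {}g : ent P (fun t => (a t, s t)) <= - \big[Rplus/0]_t (P t * log2 (q (a t, s t))).
  apply: g => t Pt; apply: Rmult_lt_0_compat; last exact: k0.
  exact: marg_gt0.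
have e : \big[Rplus/0]_t (P t * log2 (q (a t, s t))) =
    - ent P s + \big[Rplus/0]_t (P t * log2 (k (a t, s t))).
  rewrite entE // Ropp_involutive -big_split; apply: eq_bigr => t _ /=.
  have [Pt|<-] := Rle_lt_or_eq_dec _ _ (P0 t); last lra.
  rewrite /q log2_mul //; last exact: marg_gt0.
  by rewrite /=; ring.
(* The guess [k] is at least [1 - delta] where the decoder is right and equals [delta] over the size
   of [A] where it is wrong. *)
have l : (1 - err) * log2 (1 - delta) + err * (log2 delta - log2 (INR #|A|)) <=
    \big[Rplus/0]_t (P t * log2 (k (a t, s t))).
  have -> : 1 - err = \big[Rplus/0]_(t | dec (s t) == a t) P t.
    by rewrite -P1 /rsum (bigID (fun t => dec (s t) == a t)) /= /err; ring.
  rewrite [X in _ <= X](bigID (fun t => dec (s t) == a t)) /= /err !big_distrl /=.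
  apply: Rplus_le_compat; apply: sumR_le => t; rewrite /k /=.
    move=> ->; apply: Rmult_le_compat_l => //. apply: log2_le; first lra.
    by move: (delta / INR #|A|) dN => e1 e0; lra.
  move=> /negbTE ->; apply: Rmult_le_compat_l => //.
  rewrite Rplus_0_l; move: (INR #|A|) N0 => N N0.
  by rewrite /Rdiv log2_mul ?log2_inv //; [lra | lra | apply: Rinv_0_lt_compat].
have err0 : 0 <= err by apply: sumR_ge0.
have l1 : log2 (1 - delta) <= 0 by rewrite -log2_1; apply: log2_le; lra.
have l2 : log2 delta <= 0 by rewrite -log2_1; apply: log2_le; lra.
have m1 : err * log2 (1 - delta) <= 0 by nra.
have m2 : delta * log2 delta <= err * log2 delta by nra.
move: g; rewrite e /cent; lra.
Qed.

(** * Memoryless laws *)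

(** The codeword is absorbed into the kernel: given the message, the letters are independent, with
    laws that depend on the position. *)
Definition memoryless (S : finType) (n M : nat) (K : 'I_M -> 'I_n -> S -> R)
    (o : 'I_M * {ffun 'I_n -> S}) : R :=
  / INR M * \big[Rmult/1]_(i < n) K o.1 i (o.2 i).

(** Invariance under this overwriting is how a variable is said to ignore letter [i]. *)
Definition resample (S : finType) (n : nat) (s : {ffun 'I_n -> S}) (i : 'I_n) (b : S) :
    {ffun 'I_n -> S} := [ffun j => if j == i then b else s j].

(* Padding with [None] puts histories of all lengths in one finite type. *)
Definition history (S A : finType) (n : nat) (tau : S -> A) (k : nat)
    (s : {ffun 'I_n -> S}) : {ffun 'I_n -> option A} :=
  [ffun j : 'I_n => if (j < k)%N then Some (tau (s j)) else None].

Lemma history_eqP (S A : finType) (n : nat) (tau : S -> A) (k : nat) (s s' : {ffun 'I_n -> S}) :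
  reflect (forall j : 'I_n, (j < k)%N -> tau (s j) = tau (s' j))
          (history tau k s == history tau k s').
Proof.
apply: (iffP eqP) => [e j jk|e]; last first.
  by apply/ffunP => j; rewrite !ffunE; case: ifP => // /e ->.
by have := congr1 (fun f : {ffun 'I_n -> option A} => f j) e; rewrite !ffunE jk => -[].
Qed.

Lemma history_resample (S A : finType) (n : nat) (tau : S -> A) (i : 'I_n) s b :
  history tau i (resample s i b) = history tau i s.
Proof.
apply/eqP/history_eqP => j ji; rewrite ffunE; case: eqP => // e.
by rewrite e ltnn in ji.
Qed.

Lemma history_snd (A B : finType) (n : nat) (k : nat) (s s' : {ffun 'I_n -> A * B}) :
  history id k s = history id k s' -> history snd k s = history snd k s'.
Proof. by move/eqP/history_eqP => h; apply/eqP/history_eqP => j /h ->. Qed.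

Section Memoryless.
Variables (S : finType) (n M : nat) (K : 'I_M -> 'I_n -> S -> R).
Hypothesis (M0 : (0 < M)%N) (Kp : forall w i, pmf (K w i)).
Notation T := ('I_M * {ffun 'I_n -> S})%type.
Notation P := (@memoryless S n M K).

Lemma memoryless_ge0 o : 0 <= P o.
Proof.
apply: Rmult_le_pos; first by apply/Rlt_le/Rinv_0_lt_compat/INR_gt0.
by apply: prodR_ge0 => i; case: (Kp o.1 i).
Qed.

Lemma sum_prod_pmf w : \big[Rplus/0]_(s : {ffun 'I_n -> S}) \big[Rmult/1]_(i < n) K w i (s i) = 1.
Proof. by rewrite -bigA_distr_bigA big1 // => i _; case: (Kp w i). Qed.

Lemma marg_memoryless_fst w : marg P fst w = / INR M.
Proof.
rewrite /marg (eq_bigl (fun o : T => (o.1 == w) && true)); last by move=> o; rewrite andbT.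
rewrite -(pair_big (fun v => v == w) xpredT (fun v s => P (v, s))) /= big_pred1_eq.
by rewrite /memoryless -big_distrr /= sum_prod_pmf; lra.
Qed.

Lemma rsum_memoryless : rsum P = 1.
Proof.
rewrite -(sum_margT P fst) /rsum (eq_bigr _ (fun w _ => marg_memoryless_fst w)).
by rewrite sumR_const card_ord; field; have := INR_gt0 M0; lra.
Qed.

(** Given the message, letter [i] is independent of whatever ignores it; [z] may use the message and
    all other letters, earlier or later. *)
Lemma marg_letter1 (Z : finType) (z : T -> Z) i b v :
  (forall w (s : {ffun 'I_n -> S}) c, z (w, resample s i c) = z (w, s)) ->
  marg P (fun o : T =>  (o.2 i, z o)) (b, v) =
  \big[Rplus/0]_(o : T | z o == v) (P o * K o.1 i b).
Proof.
move=> zi; rewrite /marg.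
have e1 : \big[Rplus/0]_(o : T | (o.2 i, z o) == (b, v)) P o =
   \big[Rplus/0]_w \big[Rplus/0]_(s : {ffun 'I_n -> S} | (s i == b) && (z (w, s) == v)) P (w, s).
  by rewrite (pair_big_dep xpredT (fun w (s : {ffun 'I_n -> S}) => (s i == b) && (z (w, s) == v))
    (fun w (s : {ffun 'I_n -> S}) => P (w, s)));
    apply: eq_big => [[w s]|[w s]].
have e2 : \big[Rplus/0]_(o : T | z o == v) (P o * K o.1 i b) =
   \big[Rplus/0]_w \big[Rplus/0]_(s : {ffun 'I_n -> S} | z (w, s) == v) (P (w, s) * K w i b).
  by rewrite (pair_big_dep xpredT (fun w (s : {ffun 'I_n -> S}) => z (w, s) == v)
    (fun w (s : {ffun 'I_n -> S}) => P (w, s) * K w i b));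
    apply: eq_big => [[w s]|[w s]].
rewrite e1 e2; apply: eq_bigr => w _.
pose rest (s : {ffun 'I_n -> S}) := / INR M * \big[Rmult/1]_(j | j != i) K w j (s j).
have Pw s : P (w, s) = K w i (s i) * rest s.
  by rewrite /memoryless (bigD1 i) //= -!Rmult_assoc (Rmult_comm (K w i _)).
pose N := \big[Rplus/0]_(s : {ffun 'I_n -> S} | (s i == b) && (z (w, s) == v)) rest s.
(* Given [w], the event [s i = c] has mass proportional to [K w i c], with a factor [N]
   independent of [c], because [z] does not see the letter [i]. *)
have fiber c : \big[Rplus/0]_(s : {ffun 'I_n -> S} | (s i == c) && (z (w, s) == v)) P (w, s) = K w i c * N.
  (* Overwriting letter [i] is a bijection between the fibers over [b] and [c]. *)
  rewrite /N big_distrr /= [RHS](reindex_onto (fun s : {ffun 'I_n -> S} => resample s i b)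
    (fun s : {ffun 'I_n -> S} => resample s i c)).
    apply: eq_big => [s|s /andP[/eqP <- _]].
      rewrite zi ffunE eqxx eqxx /= andbC; congr (_ && _).
      apply/eqP/eqP => [<-|<-]; last by rewrite ffunE eqxx.
      by apply/ffunP => j; rewrite !ffunE; case: eqP => [->|].
    rewrite Pw; congr (_ * (_ * _)); apply: eq_bigr => j ji.
    by rewrite ffunE (negbTE ji).
  move=> s /andP[/eqP sb _]; apply/ffunP => j; rewrite !ffunE.
  by case: eqP => // ->.
(* The right side is split by the value [c] of letter [i]; since [K w i] has total mass 1, the
   fibers add up to [N]. *)
rewrite fiber (partition_big (fun s : {ffun 'I_n -> S} => s i) xpredT) //=.
rewrite -[LHS]Rmult_1_l; have [_ <-] := Kp w i; rewrite /rsum big_distrl /=.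
apply: eq_bigr => c _; rewrite -big_distrl /=.
rewrite (eq_bigl (fun s : {ffun 'I_n -> S} => (s i == c) && (z (w, s) == v))); last first.
  by move=> s; rewrite andbC.
by rewrite fiber; ring.
Qed.

Lemma marg_letter (A Z : finType) (tau : S -> A) (z : T -> Z) i a v :
  (forall w (s : {ffun 'I_n -> S}) c, z (w, resample s i c) = z (w, s)) ->
  marg P (fun o : T => (tau (o.2 i), z o)) (a, v) =
  \big[Rplus/0]_(o : T | z o == v) (P o * marg (K o.1 i) tau a).
Proof.
move=> zi; rewrite /marg (partition_big (fun o : T => o.2 i) (fun b => tau b == a)); last first.
  by move=> o; rewrite xpair_eqE => /andP[].
under [RHS]eq_bigr => o _ do rewrite big_distrr /=.
rewrite exchange_big /=; apply: eq_bigr => b /eqP tb.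
rewrite -marg_letter1 // /marg; apply: eq_bigl => o.
rewrite !xpair_eqE andbC; case: eqP => //= ->; by rewrite tb eqxx.
Qed.

Lemma transition_letter (A Z : finType) (tau : S -> A) (z : T -> Z) i (L : Z -> A -> R) :
  (forall w (s : {ffun 'I_n -> S}) c, z (w, resample s i c) = z (w, s)) ->
  (forall (o : T) a, marg (K o.1 i) tau a = L (z o) a) ->
  transition P (fun o : T => tau (o.2 i)) z L.
Proof.
move=> zi KL v a; rewrite marg_letter // /marg big_distrl /=.
by apply: eq_bigr => o /eqP <-; rewrite -KL.
Qed.

(** Each summand is the increment of the joint entropy of [z] and the history when one letter is
    added, so the sum telescopes; the history of length 0 is constant. *)
Lemma chain_rule (A Z : finType) (tau : S -> A) (z : T -> Z) :
  cent P (fun o : T => history tau n o.2) z =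
  \big[Rplus/0]_(i < n) cent P (fun o : T => tau (o.2 i)) (fun o : T => (history tau i o.2, z o)).
Proof.
have P0 := memoryless_ge0.
pose F k := ent P (fun o : T => (history tau k o.2, z o)).
have step (i : 'I_n) :
    cent P (fun o : T => tau (o.2 i)) (fun o : T => (history tau i o.2, z o)) = F i.+1 - F i.
  congr (_ - _); apply: eq_ent => // o o'; rewrite !xpair_eqE andbA; congr (_ && _).
  apply/andP/history_eqP => [[/eqP e /history_eqP h] j|h].
    by rewrite ltnS leq_eqVlt => /predU1P[/val_inj ->|/h].
  by split; [apply/eqP/h | apply/history_eqP => j ji; apply/h/ltnW].
rewrite (eq_bigr _ (fun i _ => step i)) /cent.
have -> : ent P z = F 0%N.
  apply: eq_ent => // o o'; rewrite xpair_eqE.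
  by have -> : history tau 0 o.2 == history tau 0 o'.2 by apply/history_eqP.
rewrite -/(F n); elim: (n) => [|m IH]; first by rewrite big_ord0; lra.
by rewrite big_ord_recr /= -IH; lra.
Qed.

End Memoryless.

(** * The converse for a single code *)

Definition letter_law (X1 X2 Y U : finType) (W : X1 -> X2 -> Y -> R) (pu : Y -> U -> R)
  (x : X1 * X2) (s : Y * U) : R := W x.1 x.2 s.1 * pu s.1 s.2.

Lemma pmf_letter (X1 X2 Y U : finType) (W : X1 -> X2 -> Y -> R) (pu : Y -> U -> R) x :
  channel W -> (forall y, pmf (pu y)) -> pmf (letter_law W pu x).
Proof.
move=> Wp pup; have [W0 W1] := Wp x.1 x.2; split.
  by move=> s; apply: Rmult_le_pos => //; case: (pup s.1).
rewrite /rsum -(pair_bigA _ (fun y u => letter_law W pu x (y, u))) /letter_law /= -W1.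
apply: eq_bigr => y _; rewrite -big_distrr /=; have [_] := pup y.
by rewrite /rsum => ->; lra.
Qed.

Lemma marg_letter_fst (X1 X2 Y U : finType) (W : X1 -> X2 -> Y -> R) (pu : Y -> U -> R) x y :
  (forall y, pmf (pu y)) -> marg (letter_law W pu x) fst y = W x.1 x.2 y.
Proof.
move=> pup; rewrite /marg (eq_bigl (fun o : Y * U => (o.1 == y) && true)); last by move=> o; rewrite andbT.
rewrite -(pair_big (fun v => v == y) xpredT (fun v s => letter_law W pu x (v, s))) /= big_pred1_eq.
rewrite /letter_law /= -big_distrr /=; have [_] := pup y.
by rewrite /rsum => ->; lra.
Qed.

Section Converse.
Variables (X1 X2 Y U : finType) (W : X1 -> X2 -> Y -> R) (pu : Y -> U -> R).
Hypotheses (Wp : channel W) (pup : forall y, pmf (pu y)).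
Variables (n M : nat) (V1 V2 : finType) (f1 : 'I_M -> V1) (f2 : 'I_M -> V2)
  (g1 : V1 -> {ffun 'I_n -> X1}) (g2 : V2 -> {ffun 'I_n -> X2}).
Hypothesis M0 : (0 < M)%N.
Notation T := ('I_M * {ffun 'I_n -> Y * U})%type.

Definition code_letter (w : 'I_M) (i : 'I_n) : Y * U -> R :=
  letter_law W pu (g1 (f1 w) i, g2 (f2 w) i).

Definition code_law : T -> R := memoryless code_letter.

Notation P := code_law.
Notation v1 := (fun o : T => f1 o.1).
Notation v2 := (fun o : T => f2 o.1).
Notation v12 := (fun o : T => (f1 o.1, f2 o.1)).
Notation x1 i := (fun o : T => g1 (f1 o.1) i).
Notation x2 i := (fun o : T => g2 (f2 o.1) i).
Notation x12 i := (fun o : T => (g1 (f1 o.1) i, g2 (f2 o.1) i)).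
Notation s i := (fun o : T => o.2 i).
Notation y i := (fun o : T => (o.2 i).1).
Notation u i := (fun o : T => (o.2 i).2).
Notation q i := (fun o : T => (i, history snd i o.2)).
Notation x1q i := (fun o : T => (g1 (f1 o.1) i, (i, history snd i o.2))).
Notation x2q i := (fun o : T => (g2 (f2 o.1) i, (i, history snd i o.2))).

Lemma pmf_code_letter w i : pmf (code_letter w i).
Proof. exact: pmf_letter. Qed.

Lemma code_law_ge0 o : 0 <= P o.
Proof. exact: (memoryless_ge0 M0 pmf_code_letter). Qed.

Lemma sum_code_law : rsum P = 1.
Proof. exact: (rsum_memoryless M0 pmf_code_letter). Qed.

Lemma pmf_code_law : pmf P.
Proof. by split; [exact: code_law_ge0 | exact: sum_code_law]. Qed.

Let P0 := code_law_ge0.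
Let P1 := sum_code_law.

(** In order: H(S_i | X_1i, X_2i), H(U_i | X_1i, X_2i) and H(U_i | Y_i). Being averages over
    explicit kernels, they mention no conditioning variable and can serve as common values for many
    of them. *)
Definition letter_entropy i := \big[Rplus/0]_o (P o * - rsum (fun b => xlogx (code_letter o.1 i b))).
Definition side_entropy i := \big[Rplus/0]_o (P o * - rsum (fun b => xlogx (marg (code_letter o.1 i) snd b))).
Definition side_noise_entropy i := \big[Rplus/0]_o (P o * - rsum (fun b => xlogx (pu (o.2 i).1 b))).

(** The Markov property of the channel: if [z] ignores letter [i] and determines both inputs through
    [phi], the conditional law of the letter is the channel law, whatever else [z] contains. *)
Lemma cent_letter (Z : finType) (z : T -> Z) (phi : Z -> X1 * X2) i :
  (forall w (s : {ffun 'I_n -> Y * U}) c, z (w, resample s i c) = z (w, s)) ->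
  (forall o, phi (z o) = (g1 (f1 o.1) i, g2 (f2 o.1) i)) -> cent P (s i) z = letter_entropy i.
Proof.
move=> zi zphi.
have tr := @transition_letter _ _ _ _ pmf_code_letter _ _ id z i (fun v => letter_law W pu (phi v)) zi.
rewrite (cent_transition P0 _ (tr _)).
- by apply: eq_bigr => o _; rewrite zphi.
- by move=> v; apply: pmf_letter.
- by move=> o a; rewrite zphi /marg (big_pred1 a).
Qed.

Lemma cent_side (Z : finType) (z : T -> Z) (phi : Z -> X1 * X2) i :
  (forall w (s : {ffun 'I_n -> Y * U}) c, z (w, resample s i c) = z (w, s)) ->
  (forall o, phi (z o) = (g1 (f1 o.1) i, g2 (f2 o.1) i)) -> cent P (u i) z = side_entropy i.
Proof.
move=> zi zphi.
have tr := @transition_letter _ _ _ _ pmf_code_letter _ _ snd z i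
  (fun v => marg (letter_law W pu (phi v)) snd) zi.
rewrite (cent_transition P0 _ (tr _)).
- by apply: eq_bigr => o _; rewrite zphi.
- by move=> v; apply/pmf_marg/pmf_letter.
- by move=> o a; rewrite zphi.
Qed.

(** Since U_i is drawn from Y_i alone, H(U_i | Y_i, z) does not depend on [z]. Replacing Y_i by S_i
    thus costs a constant that cancels in every mutual information. *)
Lemma cent_Y (Z : finType) (z : T -> Z) i :
  (forall w (s : {ffun 'I_n -> Y * U}) c, z (w, resample s i c) = z (w, s)) ->
  cent P (y i) z = cent P (s i) z - side_noise_entropy i.
Proof.
move=> zi.
have tr : transition P (u i) (fun o : T => ((o.2 i).1, z o)) (fun v => pu v.1).
  move=> [a v] b /=.
  rewrite (@marg_letter _ _ _ _ pmf_code_letter _ _ fst) // big_distrl /=.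
  have -> : marg P (fun o : T => ((o.2 i).2, ((o.2 i).1, z o))) (b, (a, v)) =
            marg P (fun o : T => (o.2 i, z o)) ((a, b), v).
    by apply: eq_bigl => o; case: (o.2 i) => c d; rewrite !xpair_eqE; case: (c == a); case: (d == b).
  rewrite (marg_letter1 pmf_code_letter) //; apply: eq_bigr => o _.
  by rewrite marg_letter_fst // /code_letter /letter_law /=; ring.
have := cent_transition P0 _ tr; rewrite -/(side_noise_entropy i) => <- //.
have e : ent P (fun o : T => ((o.2 i).2, ((o.2 i).1, z o))) = ent P (fun o : T => (o.2 i, z o)).
  apply: eq_ent => // o o'; case: (o.2 i) => c d; case: (o'.2 i) => c' d' /=; rewrite !xpair_eqE.
  by case: (c == c'); case: (d == d').
by rewrite /cent /= e; lra.
Qed.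


(** [side_noise_entropy] cancels between the two conditional entropies, and the one conditioned on
    both inputs collapses to [letter_entropy]. The next two lemmas follow the same pattern. *)
Lemma cmi_X2_Y i : cmi P (x2 i) (y i) (x1q i) = cent P (s i) (x1q i) - letter_entropy i.
Proof.
rewrite cmi_cent // !cent_Y => [|w s c|w s c] /=; rewrite ?history_resample //.
rewrite (@cent_letter _ _ (fun z => (z.2.1, z.1))) => [|w s c|] //=; rewrite ?history_resample //.
by lra.
Qed.

Lemma cmi_X1_Y i : cmi P (x1 i) (y i) (x2q i) = cent P (s i) (x2q i) - letter_entropy i.
Proof.
rewrite cmi_cent // !cent_Y => [|w s c|w s c] /=; rewrite ?history_resample //.
rewrite (@cent_letter _ _ (fun z => (z.1, z.2.1))) => [|w s c|] //=; rewrite ?history_resample //.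
by lra.
Qed.

Lemma cmi_X12_Y i : cmi P (x12 i) (y i) (q i) = cent P (s i) (q i) - letter_entropy i.
Proof.
rewrite cmi_cent // !cent_Y => [|w s c|w s c] /=; rewrite ?history_resample //.
rewrite (@cent_letter _ _ (fun z => z.1)) => [|w s c|] //=; rewrite ?history_resample //.
by lra.
Qed.

Lemma cmi_X12_U i : cmi P (x12 i) (u i) (q i) = cent P (u i) (q i) - side_entropy i.
Proof.
by rewrite cmi_cent // (@cent_side _ (fun o : T => (x12 i o, q i o)) (fun z => z.1))
  => [|w s c|] //=; rewrite ?history_resample.
Qed.

Lemma cmi_X2_U i : cmi P (x2 i) (u i) (x1q i) = cent P (u i) (x1q i) - side_entropy i.
Proof.
by rewrite cmi_cent // (@cent_side _ (fun o : T => (x2 i o, x1q i o)) (fun z => (z.2.1, z.1)))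
  => [|w s c|] //=; rewrite ?history_resample.
Qed.

Lemma cmi_X1_U i : cmi P (x1 i) (u i) (x2q i) = cent P (u i) (x2q i) - side_entropy i.
Proof.
by rewrite cmi_cent // (@cent_side _ (fun o : T => (x1 i o, x2q i o)) (fun z => (z.1, z.2.1)))
  => [|w s c|] //=; rewrite ?history_resample.
Qed.

(* This is I(W; Y^n, U^n). *)
Definition block_info := ent P snd - \big[Rplus/0]_i letter_entropy i.

Lemma ent_block (Z : finType) (z : T -> Z) :
  ent P (fun o : T => (o.2, z o)) = ent P z +
  \big[Rplus/0]_(i < n) cent P (s i) (fun o : T => (history id i o.2, z o)).
Proof.
have h : cent P (fun o : T => history id n o.2) z =
    \big[Rplus/0]_(i < n) cent P (s i) (fun o : T => (history id i o.2, z o)).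
  exact: (chain_rule M0 pmf_code_letter id z).
have e : ent P (fun o : T => (o.2, z o)) = ent P (fun o : T => (history id n o.2, z o)).
  apply: eq_ent => // o o'; rewrite !xpair_eqE; congr (_ && _).
  by apply/eqP/history_eqP => [->//|e]; apply/ffunP => j; apply: e.
by rewrite -h e; apply/esym/Rplus_minus.
Qed.

(** H(S^n) is at most H(S^n, z), which the chain rule expands; each conditioning (S^(i-1), z) is
    then coarsened to [c i]. With [z] equal to V_1, V_2 or a constant this gives three of the five
    bounds. *)
Lemma block_info_cent (Z : finType) (z : 'I_M -> Z) (Z' : finType)
    (c : 'I_n -> T -> Z') :
  (forall (i : 'I_n) (o o' : T), history id i o.2 = history id i o'.2 -> z o.1 = z o'.1 -> c i o = c i o') ->
  block_info <= ent P (fun o : T => z o.1) +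
    \big[Rplus/0]_i (cent P (s i) (c i) - letter_entropy i).
Proof.
move=> h; rewrite /block_info sumRB.
have le : ent P snd <= ent P (fun o : T => (o.2, z o.1)).
  by apply: ent_le => // o o' [].
rewrite ent_block in le.
suff : \big[Rplus/0]_(i < n) cent P (s i) (fun o : T => (history id i o.2, z o.1)) <=
   \big[Rplus/0]_i cent P (s i) (c i) by lra.
apply: sumR_le => i _; apply: cent_le => // o o' [e1 e2]; exact: h.
Qed.


Lemma block_info_le_X1 (v := ent P v1) :
  block_info <= v + \big[Rplus/0]_i cmi P (x2 i) (y i) (x1q i).
Proof.
rewrite (eq_bigr _ (fun i _ => cmi_X2_Y i)).
apply: (block_info_cent (z := f1) (c := fun i => x1q i)) => i o o' /= e ->.
by rewrite (history_snd e).
Qed.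

Lemma block_info_le_X2 (v := ent P v2) :
  block_info <= v + \big[Rplus/0]_i cmi P (x1 i) (y i) (x2q i).
Proof.
rewrite (eq_bigr _ (fun i _ => cmi_X1_Y i)).
apply: (block_info_cent (z := f2) (c := fun i => x2q i)) => i o o' /= e ->.
by rewrite (history_snd e).
Qed.

Lemma block_info_le_X12 :
  block_info <= \big[Rplus/0]_i cmi P (x12 i) (y i) (q i).
Proof.
rewrite (eq_bigr _ (fun i _ => cmi_X12_Y i)).
have := @block_info_cent _ (fun=> tt) _ (fun i => q i).
rewrite ent_unit // Rplus_0_l; apply=> i o o' /= e _.
by rewrite (history_snd e).
Qed.

(** When [z] determines the inputs at every time, the past letters add nothing and each term of the
    chain rule is exact. *)
Lemma ent_block_determined (Z : finType) (z : 'I_M -> Z) (phi : 'I_n -> Z -> X1 * X2) :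
  (forall i w, phi i (z w) = (g1 (f1 w) i, g2 (f2 w) i)) ->
  ent P (fun o : T => (o.2, z o.1)) = ent P (fun o : T => z o.1) + \big[Rplus/0]_i letter_entropy i.
Proof.
move=> h; rewrite ent_block; congr (_ + _); apply: eq_bigr => i _.
apply: (@cent_letter _ _ (fun v => phi i v.2)) => [w s c|o]; last exact: h.
by rewrite /= history_resample.
Qed.

Lemma block_info_le_joint : block_info <= ent P v12.
Proof.
have h := @ent_block_determined _ (fun w => (f1 w, f2 w))
  (fun i v => (g1 v.1 i, g2 v.2 i)) (fun i w => erefl).
have le : ent P snd <= ent P (fun o : T => (o.2, (f1 o.1, f2 o.1))).
  by apply: ent_le => // o o' [].
by move: le; rewrite h /block_info; lra.
Qed.

Lemma block_info_le_sum : block_info <= ent P v1 + ent P v2.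
Proof. by apply: (Rle_trans _ _ _ block_info_le_joint); apply: ent_pair_le; exact: pmf_code_law. Qed.

Notation us := (fun o : T => history snd n o.2).

Lemma cent_us (Z : finType) (z : 'I_M -> Z) :
  cent P us (fun o : T => z o.1) =
  \big[Rplus/0]_(i < n) cent P (u i) (fun o : T => (history snd i o.2, z o.1)).
Proof. exact: (chain_rule M0 pmf_code_letter snd). Qed.

Lemma block_info_le_U :
  block_info <= ent P v1 + ent P v2 + \big[Rplus/0]_i
    (- cmi P (x12 i) (u i) (q i) + cmi P (x2 i) (u i) (x1q i) + cmi P (x1 i) (u i) (x2q i)).
Proof.
(* I(V_1;V_2|U^n) is nonnegative; [e1] to [e4] rewrite it so that H(V_1,V_2) is at most H(V_1) +
   H(V_2) + H(U^n|V_1) + H(U^n|V_2) - H(U^n|V_1,V_2) - H(U^n). *)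
have cm := cmi_ge0 P0 v1 v2 us P1.
have e1 : ent P (fun o : T => (f1 o.1, history snd n o.2)) = ent P v1 + cent P us v1.
  rewrite /cent Rplus_minus; apply: eq_ent => // o o'; by rewrite !xpair_eqE andbC.
have e2 : ent P (fun o : T => (f2 o.1, history snd n o.2)) = ent P v2 + cent P us v2.
  rewrite /cent Rplus_minus; apply: eq_ent => // o o'; by rewrite !xpair_eqE andbC.
have e3 : ent P (fun o : T => (f1 o.1, f2 o.1, history snd n o.2)) = ent P v12 + cent P us v12.
  rewrite /cent Rplus_minus; apply: eq_ent => // o o'; by rewrite !xpair_eqE andbC.
have e4 : ent P us = cent P us (fun o : T => (fun=> tt) o.1).
  rewrite /cent (ent_unit P1) Rminus_0_r; apply: eq_ent => // o o'; by rewrite xpair_eqE andbT.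
have l1 : cent P us v1 <= \big[Rplus/0]_i cent P (u i) (x1q i).
  rewrite (cent_us f1); apply: sumR_le => i _; by apply: cent_le => // o o' [-> ->].
have l2 : cent P us v2 <= \big[Rplus/0]_i cent P (u i) (x2q i).
  rewrite (cent_us f2); apply: sumR_le => i _; by apply: cent_le => // o o' [-> ->].
(* The terms with a plus sign may be enlarged by coarsening V_k to the current input, but the two
   with a minus sign have to be exact. *)
have l3 : cent P us v12 = \big[Rplus/0]_i side_entropy i.
  rewrite (cent_us (fun w => (f1 w, f2 w))); apply: eq_bigr => i _.
  apply: (@cent_side _ _ (fun v => (g1 v.2.1 i, g2 v.2.2 i))) => //= w s c.
  by rewrite history_resample.
have l4 : ent P us = \big[Rplus/0]_i cent P (u i) (q i).
  rewrite e4 (cent_us (fun=> tt)); apply: eq_bigr => i _; rewrite /cent; congr (_ - _).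
    by apply: eq_ent => // o o'; rewrite !xpair_eqE !eqxx ?andbT.
  by apply: eq_ent => // o o'; rewrite !xpair_eqE !eqxx ?andbT.
have -> : \big[Rplus/0]_i
    (- cmi P (x12 i) (u i) (q i) + cmi P (x2 i) (u i) (x1q i) + cmi P (x1 i) (u i) (x2q i)) =
    \big[Rplus/0]_i cent P (u i) (x1q i) + \big[Rplus/0]_i cent P (u i) (x2q i)
    - \big[Rplus/0]_i side_entropy i - \big[Rplus/0]_i cent P (u i) (q i).
  rewrite -big_split -!sumRB; apply: eq_bigr => i _ /=.
  rewrite cmi_X12_U cmi_X2_U cmi_X1_U.
  move: (cent P (u i) (q i)) (cent P (u i) (x1q i)) (cent P (u i) (x2q i)) (side_entropy i).
  by move=> *; ring.
have := block_info_le_joint.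
move: cm; rewrite /cmi; move: e1 e2 e3 l1 l2 l3 l4.
move: (\big[Rplus/0]_i side_entropy i) (\big[Rplus/0]_i cent P (u i) (x1q i))
  (\big[Rplus/0]_i cent P (u i) (x2q i))
  (\big[Rplus/0]_i cent P (u i) (q i)) => a b c d.
move=> -> -> -> *; lra.
Qed.

End Converse.

(** * Time sharing *)

Definition mixture (I T : finType) (P : T -> R) (t : I * T) : R := / INR #|I| * P t.2.

Lemma marg_mixture (I T S : finType) (P : T -> R) (f : I * T -> S) v :
  marg (mixture P) f v = \big[Rplus/0]_i (/ INR #|I| * marg P (fun o => f (i, o)) v).
Proof.
rewrite /marg; under [RHS]eq_bigr => i _ do rewrite big_distrr /=.
rewrite (pair_big_dep xpredT (fun i o => f (i, o) == v) (fun i o => / INR #|I| * P o)) /=.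
by apply: eq_bigl => [[i o]].
Qed.

Lemma pmf_mixture (I T : finType) (P : T -> R) : (0 < #|I|)%N -> pmf P -> pmf (@mixture I T P).
Proof.
move=> I0 [P0 P1]; have i0 := INR_gt0 I0; split.
  by move=> t; apply: Rmult_le_pos => //; apply/Rlt_le/Rinv_0_lt_compat.
rewrite /rsum -(pair_bigA _ (fun i o => mixture P (i, o))) /mixture /=.
under eq_bigr => i _ do rewrite -big_distrr /= -/(rsum P) P1.
by rewrite sumR_const; move: (INR #|I|) i0 => N N0; field; lra.
Qed.

(** Because [f] reveals the index, the components have disjoint images, so each marginal is a single
    component's marginal scaled by the uniform weight. *)
Lemma ent_mixture (I T S : finType) (P : T -> R) (f : I * T -> S) :
  (0 < #|I|)%N -> pmf P -> (forall t t', f t = f t' -> t.1 = t'.1) ->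
  ent (mixture P) f = log2 (INR #|I|) + / INR #|I| * \big[Rplus/0]_i ent P (fun o => f (i, o)).
Proof.
move=> I0 pP h; have i0 := INR_gt0 I0; have [m0 _] := pmf_mixture I0 pP; have [P0 P1] := pP.
have ii := Rinv_0_lt_compat _ i0.
rewrite entE // [X in - X](_ : _ = \big[Rplus/0]_i \big[Rplus/0]_o
    (mixture P (i, o) * log2 (marg (mixture P) f (f (i, o))))); last first.
  by rewrite pair_bigA; apply: eq_bigr => [[i o]].
have e i : \big[Rplus/0]_o (mixture P (i, o) * log2 (marg (mixture P) f (f (i, o)))) =
    - (/ INR #|I| * (log2 (INR #|I|) + ent P (fun o => f (i, o)))).
  rewrite entE // Rmult_plus_distr_l Ropp_plus_distr.
  have -> : - (/ INR #|I| * log2 (INR #|I|)) = \big[Rplus/0]_o (P o * (/ INR #|I| * - log2 (INR #|I|))).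
    by rewrite -big_distrl /= -/(rsum P) P1; ring.
  rewrite Ropp_mult_distr_r Ropp_involutive big_distrr -big_split /=; apply: eq_bigr => o _.
  rewrite /mixture /=; have [Po|<-] := Rle_lt_or_eq_dec _ _ (P0 o); last lra.
  have -> : marg (@mixture I T P) f (f (i, o)) = / INR #|I| * marg P (fun o' => f (i, o')) (f (i, o)).
    rewrite marg_mixture (bigD1 i) //= big1 ?Rplus_0_r // => j ji.
    rewrite /marg big1 ?Rmult_0_r // => o' /eqP /h /= e; by rewrite e eqxx in ji.
  have : 0 < marg P (fun o' => f (i, o')) (f (i, o)) by apply: (marg_gt0 P0 (fun o => f (i, o))).
  move: (INR #|I|) (marg P _ _) i0 ii => N m N0 iN0 mp.
  by rewrite log2_mul ?log2_inv //; ring.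
rewrite (eq_bigr _ (fun i _ => e i)) sumRN Ropp_involutive -big_distrr /= big_split /= sumR_const.
by move: (INR #|I|) i0 => N N0; field; lra.
Qed.

(** The conditioning variable reveals the index, so all four entropies carry the same [log2] of the
    size of [I], and these cancel. *)
Lemma cmi_mixture (I T A B C : finType) (P : T -> R) (a : I * T -> A) (b : I * T -> B)
    (c : I * T -> C) :
  (0 < #|I|)%N -> pmf P -> (forall t t', c t = c t' -> t.1 = t'.1) ->
  cmi (mixture P) a b c = / INR #|I| *
    \big[Rplus/0]_i cmi P (fun o => a (i, o)) (fun o => b (i, o)) (fun o => c (i, o)).
Proof.
move=> I0 pP h; rewrite /cmi !ent_mixture //; try by move=> t t' [] *; apply: h.
rewrite [in RHS]sumRB [in RHS]sumRB big_split /=; ring.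
Qed.

Lemma cmi_marg (T S A B C : finType) (P : T -> R) (f : T -> S) (a : S -> A) (b : S -> B)
    (c : S -> C) :
  cmi (marg P f) a b c = cmi P (fun t => a (f t)) (fun t => b (f t)) (fun t => c (f t)).
Proof. by rewrite /cmi !ent_marg. Qed.

(** Null rows receive the point mass at [q0], so that every row of [k] is a pmf; the factorization
    survives since [G a] vanishes there. *)
Lemma disintegration (A Q : finType) (q0 : Q) (G : A -> Q -> R) :
  (forall a q, 0 <= G a q) ->
  exists k : A -> Q -> R, (forall a, pmf (k a)) /\ forall a q, rsum (G a) * k a q = G a q.
Proof.
move=> G0; exists (fun a q => if Rlt_dec 0 (rsum (G a)) then G a q / rsum (G a)
                 else if q == q0 then 1 else 0); split=> a.
  case: Rlt_dec => [s0|n0] /=; split.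
  - by move=> q; apply: Rmult_le_pos => //; apply/Rlt_le/Rinv_0_lt_compat.
  - by rewrite /rsum -big_distrl /= -/(rsum (G a)); field; lra.
  - by move=> q; case: ifP => _; lra.
  - by rewrite /rsum -big_mkcond big_pred1_eq.
move=> q; case: Rlt_dec => [s0|s0] /=; first by field; lra.
have : G a q <= rsum (G a) by apply: (@sumR_ge_term _ xpredT).
have : 0 <= rsum (G a) by apply: sumR_ge0.
have := G0 a q; case: ifP => _; nra.
Qed.

(** * The single-letter bound for one code *)

Section CodeBound.
Variables (X1 X2 Y U : finType) (W : X1 -> X2 -> Y -> R) (pu : Y -> U -> R).
Hypotheses (Wp : channel W) (pup : forall y, pmf (pu y)).
Variables (n M : nat) (V1 V2 : finType) (f1 : 'I_M -> V1) (f2 : 'I_M -> V2)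
  (g1 : V1 -> {ffun 'I_n -> X1}) (g2 : V2 -> {ffun 'I_n -> X2}).
Hypotheses (M0 : (0 < M)%N) (n0 : (0 < n)%N).
Notation T := ('I_M * {ffun 'I_n -> Y * U})%type.
Notation P := (code_law W pu f1 f2 g1 g2).

Let P0 : forall o, 0 <= P o := code_law_ge0 Wp pup f1 f2 g1 g2 M0.
Let P1 : rsum P = 1 := sum_code_law Wp pup f1 f2 g1 g2 M0.
Let pP : pmf P := conj P0 P1.

Lemma marg_code_law_message : marg P (fun o : T => o.1) = @unif M.
Proof.
apply: functional_extensionality => w.
exact: (marg_memoryless_fst (pmf_code_letter Wp pup f1 f2 g1 g2)).
Qed.

Lemma ent_message (S : finType) (f : 'I_M -> S) : ent P (fun o : T => f o.1) = ent (@unif M) f.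
Proof. by rewrite -(ent_marg P (fun o : T => o.1) f) marg_code_law_message. Qed.

Lemma ent_unif : ent (@unif M) id = log2 (INR M).
Proof.
have m0 := INR_gt0 M0; have i0 := Rinv_0_lt_compat _ m0.
rewrite /ent /rsum; under eq_bigr => w _.
  have -> : marg (@unif M) id w = / INR M by rewrite /marg (big_pred1 w).
  rewrite xlogxE ?log2_inv //; last by lra.
  over.
by rewrite sumR_const card_ord; field; lra.
Qed.

Lemma error_probE (d : {ffun 'I_n -> Y} -> 'I_M) :
  error_prob W f1 f2 g1 g2 d =
  \big[Rplus/0]_(o : T | d [ffun i => (o.2 i).1] != o.1) P o.
Proof.
pose ys (s : {ffun 'I_n -> Y * U}) := [ffun i => (s i).1].
rewrite /error_prob big_distrr /=.
transitivity (\big[Rplus/0]_w \big[Rplus/0]_(s | d (ys s) != w) P (w, s)); last first.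
  by rewrite (pair_big_dep xpredT (fun w s => d (ys s) != w) (fun w s => P (w, s))) /=;
    apply: eq_big => [[w s]|[w s]].
apply: eq_bigr => w _; rewrite (partition_big ys (fun y => d y != w)) //= /rsum big_distrr /=.
rewrite [RHS]big_mkcond /=; apply: eq_bigr => y _; case: eqP => [_|dw]; first by rewrite Rmult_0_r.
rewrite /code_law /memoryless -big_distrr /=; congr (_ * _).
(* Distributivity: summing out the side letter separately at each position recovers the product of
   channel probabilities. *)
transitivity (\big[Rplus/0]_(s in family (fun i => [pred b : Y * U | b.1 == y i]))
   \big[Rmult/1]_(i < n) code_letter W pu f1 f2 g1 g2 w i (s i)).
  rewrite -bigA_distr_big_dep; apply: eq_bigr => i _.
  by rewrite -(marg_letter_fst W (g1 (f1 w) i, g2 (f2 w) i) (y i) pup).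
apply: eq_bigl => s; apply/familyP/andP => [h|[_ /eqP <-] i]; last by rewrite !inE ffunE.
have -> : ys s = y by apply/ffunP => i; rewrite ffunE; have := h i; rewrite inE => /eqP.
by split; [apply/eqP | rewrite eqxx].
Qed.

(** The decoder is applied to S^n by ignoring U^n. As the message determines all inputs, H(W | S^n)
    is [log2 (INR M)] minus [block_info], and Fano's inequality bounds it. *)
Lemma block_info_fano (d : {ffun 'I_n -> Y} -> 'I_M) (delta : R)
    (err := error_prob W f1 f2 g1 g2 d) :
  0 < delta < 1 -> err <= delta ->
  (1 - err) * log2 (INR M) + log2 (1 - delta) + delta * log2 delta
    <= block_info W pu f1 f2 g1 g2.
Proof.
move=> dl; rewrite /err error_probE => errd.
have := fano (a := fun o : T => o.1) (s := fun o : T => o.2)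
  (dec := fun s : {ffun 'I_n -> Y * U} => d [ffun i => (s i).1]) pP dl errd.
rewrite card_ord.
have e := ent_block_determined (z := id) Wp pup M0 (phi := fun i w => (g1 (f1 w) i, g2 (f2 w) i))
  (fun i w => erefl).
have e1 : ent P (fun o : T => o.1) = log2 (INR M) by rewrite -ent_unif -(ent_message id).
have e2 : ent P (fun o : T => (o.1, o.2)) = ent P (fun o : T => (o.2, o.1)).
  by apply: eq_ent => // o o'; rewrite !xpair_eqE andbC.
rewrite /cent /block_info e2 e e1.
set h := \big[Rplus/0]_i _; move: h => h; move: (ent P _) => hs.
move: (bigop _ _ _) => er; lra.
Qed.

(** The input pair at a uniform time, built from message and code only: the maximizing input law may
    not depend on p(u|y). *)
Definition code_input : X1 * X2 -> R :=
  marg (@mixture 'I_n 'I_M (@unif M)) (fun t => (g1 (f1 t.2) t.1, g2 (f2 t.2) t.1)).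

Lemma pmf_code_input : pmf code_input.
Proof.
apply/pmf_marg/pmf_mixture; first by rewrite card_ord.
by rewrite -marg_code_law_message; apply: pmf_marg.
Qed.

Notation L := (@mixture 'I_n T P).
Notation S := ('I_n * {ffun 'I_n -> option U})%type.

Definition letter_view (t : 'I_n * T) : X1 * X2 * S * Y * U :=
  (g1 (f1 t.2.1) t.1, g2 (f2 t.2.1) t.1, (t.1, history snd t.1 t.2.2), (t.2.2 t.1).1, (t.2.2 t.1).2).

Lemma code_inputE : code_input = marg L (fun t => (letter_view t).1.1.1).
Proof.
apply: functional_extensionality => x; rewrite /code_input !marg_mixture.
apply: eq_bigr => i _; congr (_ * _).
by rewrite -marg_code_law_message marg_marg.
Qed.

(** Q = (i, U^(i-1)) ignores the current letter, so given the inputs and Q the pair (Y, U) follows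
    the channel and p(u|y). Disintegrating the law of inputs and Q supplies [pq]. *)
Lemma joint_letter_view : exists pq : X1 -> X2 -> S -> R,
  (forall x1 x2, pmf (pq x1 x2)) /\ joint W code_input pq pu = marg L letter_view.
Proof.
have [L0 _] : pmf L by apply: pmf_mixture; rewrite ?card_ord.
pose xq (t : 'I_n * T) := ((letter_view t).1.1.1, (letter_view t).1.1.2).
have [k [kp kE]] := @disintegration (X1 * X2)%type S (Ordinal n0, [ffun=> None])
  (fun x q => marg L xq (x, q)) (fun x q => marg_ge0 L0 xq (x, q)).
exists (fun x1 x2 => k (x1, x2)); split=> //.
apply: functional_extensionality => [[[[[x1 x2] [j h]] y] u]] /=.
have -> : code_input (x1, x2) * k (x1, x2) (j, h) = marg L xq ((x1, x2), (j, h)).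
  by rewrite -kE code_inputE /rsum /xq marg_pair_fst.
rewrite !marg_mixture !big_distrl /=; apply: eq_bigr => i _.
have -> : marg P (fun o => letter_view (i, o)) (x1, x2, (j, h), y, u) =
    \big[Rplus/0]_(o | xq (i, o) == ((x1, x2), (j, h))) (P o * code_letter W pu f1 f2 g1 g2 o.1 i (y, u)).
  transitivity (marg P (fun o => (o.2 i, xq (i, o))) ((y, u), ((x1, x2), (j, h)))).
    apply: eq_bigl => o; rewrite /letter_view /xq /= !xpair_eqE /=; case: (o.2 i) => c d /=.
    by rewrite !xpair_eqE -!andbA; do ! case: (_ == _).
  refine (@marg_letter1 _ _ _ (code_letter W pu f1 f2 g1 g2)
    (pmf_code_letter Wp pup f1 f2 g1 g2) _ (fun o => xq (i, o)) i (y, u) (x1, x2, (j, h)) _) => w s c.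
  by rewrite /xq /= history_resample.
rewrite !Rmult_assoc; congr (_ * _); rewrite /marg big_distrl /=.
by apply: eq_bigr => o /eqP [<- <- _].
Qed.

Lemma code_bound (C1 C2 : R) :
  ent (@unif M) f1 <= INR n * C1 -> ent (@unif M) f2 <= INR n * C2 ->
  exists pq : X1 -> X2 -> S -> R, (forall x1 x2, pmf (pq x1 x2)) /\
    / INR n * block_info W pu f1 f2 g1 g2 <= diamond_obj W C1 C2 code_input pq pu.
Proof.
rewrite -!ent_message => h1 h2; have [pq [pqp jE]] := joint_letter_view.
exists pq; split=> //; rewrite /diamond_obj jE !cmi_marg.
have N0 := INR_gt0 n0; have i0 := Rinv_0_lt_compat _ N0.
have c0 : (0 < #|'I_n|)%N by rewrite card_ord.
rewrite !cmi_mixture //; try by move=> t t' [].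
rewrite card_ord.
have scale B : block_info W pu f1 f2 g1 g2 <= INR n * B -> / INR n * block_info W pu f1 f2 g1 g2 <= B.
  move=> h; have -> : B = / INR n * (INR n * B) by field; lra.
  by apply: Rmult_le_compat_l => //; lra.
have r0 a b c : INR n * (C1 + C2 - / INR n * a + / INR n * b + / INR n * c) =
    INR n * C1 + INR n * C2 + (- a + b + c) by field; lra.
have r1 c a : INR n * (c + / INR n * a) = INR n * c + a by field; lra.
have r2 a : INR n * (/ INR n * a) = a by field; lra.
have s3 (F G H : 'I_n -> R) : \big[Rplus/0]_i (- F i + G i + H i) =
    (- \big[Rplus/0]_i F i) + \big[Rplus/0]_i G i + \big[Rplus/0]_i H i.
  by rewrite !big_split sumRN.
do ! [apply: Rmin_glb]; apply: scale; rewrite ?r0 ?r1 ?r2.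
- rewrite Rmult_plus_distr_l.
  exact: Rle_trans (block_info_le_sum Wp pup f1 f2 g1 g2 M0) (Rplus_le_compat _ _ _ _ h1 h2).
- apply: (Rle_trans _ _ _ (block_info_le_X1 Wp pup f1 f2 g1 g2 M0)).
  exact: Rplus_le_compat h1 (Rle_refl _).
- apply: (Rle_trans _ _ _ (block_info_le_X2 Wp pup f1 f2 g1 g2 M0)).
  exact: Rplus_le_compat h2 (Rle_refl _).
- exact: (block_info_le_X12 Wp pup f1 f2 g1 g2 M0).
- apply: (Rle_trans _ _ _ (block_info_le_U Wp pup f1 f2 g1 g2 M0)).
  apply: Rplus_le_compat; first exact: Rplus_le_compat h1 h2.
  by rewrite s3; apply: Rle_refl.
Qed.

End CodeBound.

(** * From a single code to achievable rates *)

Lemma fano_slack_small (A eps : R) : 0 <= A -> 0 < eps ->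
  exists delta, 0 < delta < 1 /\ delta * A - log2 (1 - delta) - delta * log2 delta <= eps.
Proof.
move=> A0 e0; have l2 := ln2_gt0; have i2 := Rinv_0_lt_compat _ l2.
(* With [delta] equal to the square of [t], each of the two logarithmic terms is at most
   [2 * t / ln 2], and [t * t * A] is at most [t * A]; together at most [t * B]. The square is what
   makes the entropy-like term linear in [t]. *)
pose B := A + 4 * / ln 2; have B0 : 0 < B by rewrite /B; lra.
pose t := Rmin (/ 2) (eps / B).
have t0 : 0 < t by apply: Rmin_glb_lt; [lra | apply: Rdiv_lt_0_compat].
have t2 : t <= / 2 by apply: Rmin_l.
have tB : t * B <= eps.
  have : t <= eps / B by apply: Rmin_r.
  move/(Rmult_le_compat_r B _ _ (Rlt_le _ _ B0)).
  by have -> : eps / B * B = eps by field; lra.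
have tt : t * t <= t / 2 by nra.
have tt0 : 0 < t * t by nra.
exists (t * t); split; first by lra.
have l1 : - ln (1 - t * t) <= 2 * t.
  have d0 : 0 < 1 - t * t by lra.
  have := ln_le_sub1 (Rinv_0_lt_compat _ d0); rewrite ln_Rinv // => h.
  have : / (1 - t * t) <= / (1 - t / 2) by apply: Rinv_le_contravar; lra.
  have : / (1 - t / 2) <= 1 + 2 * t.
    apply: (Rmult_le_reg_l (1 - t / 2)); first lra.
    by rewrite Rinv_r; [nra | lra].
  lra.
have l3 : - ((t * t) * ln (t * t)) <= 2 * t.
  have := ln_le_sub1 (Rinv_0_lt_compat _ t0); rewrite ln_Rinv // => h.
  rewrite ln_mult //.
  have e : t * t * / t = t by field; lra.
  have := Rmult_le_compat_l _ _ _ (Rlt_le _ _ tt0) h; lra.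
rewrite /log2 /Rdiv.
have -> : t * t * A - ln (1 - t * t) * / ln 2 - t * t * (ln (t * t) * / ln 2) =
  t * t * A + (- ln (1 - t * t) + - ((t * t) * ln (t * t))) * / ln 2 by ring.
have : (- ln (1 - t * t) + - ((t * t) * ln (t * t))) * / ln 2 <= (4 * t) * / ln 2.
  by apply: Rmult_le_compat_r; lra.
move: tB; rewrite /B; nra.
Qed.

Lemma log2_Rpower x : log2 (Rpower 2 x) = x.
Proof. by rewrite /log2 /Rpower ln_exp; have := ln2_gt0; move=> ?; field; lra. Qed.

Lemma diamond_converse (X1 X2 Y : finType) (W : X1 -> X2 -> Y -> R) (C1 C2 Rt : R) :
  channel W -> achievable W C1 C2 Rt -> forall eps : R, 0 < eps ->
  exists px : X1 * X2 -> R, pmf px /\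
    forall (U : finType) (pu : Y -> U -> R), (forall y, pmf (pu y)) ->
    exists (Q : finType) (pq : X1 -> X2 -> Q -> R),
      (forall x1 x2, pmf (pq x1 x2)) /\ Rt - eps <= diamond_obj W C1 C2 px pq pu.
Proof.
move=> Wp ach eps e0.
(* The absolute value covers the loss of error probability times [Rt] for either sign of the
   rate. *)
have [delta [dl slack]] := fano_slack_small (Rabs_pos Rt) e0.
have [n [M [n0 [RM [V1 [V2 [f1 [f2 [g1 [g2 [d [h1 [h2 err]]]]]]]]]]]]] := ach _ (proj1 dl).
have m0 : 0 < INR M by apply: Rlt_le_trans RM; apply: exp_pos.
have M0 : (0 < M)%N by apply/ltP/INR_lt.
(* The input law must be chosen before [U], so its properties are read off a trivial [U]. *)
have tup (y : Y) : pmf (fun _ : unit => 1).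
  by split=> [_|]; [lra | rewrite /rsum (big_pred1 tt) //; case].
exists (code_input f1 f2 g1 g2); split; first exact: (pmf_code_input Wp tup f1 f2 g1 g2 M0 n0).
move=> U pu pup.
have [pq [pqp obj]] := code_bound Wp pup g1 g2 M0 n0 h1 h2.
exists _, pq; split=> //; apply: Rle_trans obj.
have fa := block_info_fano Wp pup M0 dl (Rlt_le _ _ err).
have err0 : 0 <= error_prob W f1 f2 g1 g2 d.
  rewrite (error_probE W pup); by apply: sumR_ge0 => o _; apply: code_law_ge0.
move: fa err err0; move: (error_prob _ _ _ _ _ _) (block_info _ _ _ _ _ _) => e B fa err err0.
have rate : INR n * Rt <= log2 (INR M) by rewrite -(log2_Rpower (INR n * Rt)); apply: log2_le => //; apply: exp_pos.
have N0 := INR_gt0 n0; have i0 := Rinv_0_lt_compat _ N0.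
have N1 : 1 <= INR n by apply: (le_INR 1); apply/leP.
have a1 : (1 - e) * (INR n * Rt) <= (1 - e) * log2 (INR M) by apply: Rmult_le_compat_l; lra.
pose s := - log2 (1 - delta) - delta * log2 delta.
have s0 : 0 <= s.
  have l1 : log2 (1 - delta) <= 0 by rewrite -log2_1; apply: log2_le; lra.
  have l2 : log2 delta <= 0 by rewrite -log2_1; apply: log2_le; lra.
  rewrite /s; nra.
have a2 : INR n * ((1 - e) * Rt - s) <= B.
  (* The slack does not grow with the block length, so [n >= 1] is enough to absorb it after
     normalization. *)
  have : s <= INR n * s by nra.
  rewrite /s in s0 *; lra.
have a3 : (1 - e) * Rt - s <= / INR n * B.
  have -> : (1 - e) * Rt - s = / INR n * (INR n * ((1 - e) * Rt - s)) by field; lra.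
  by apply: Rmult_le_compat_l => //; lra.
have a4 : e * Rt <= delta * Rabs Rt.
  have := Rle_abs Rt; have := Rabs_pos Rt; nra.
rewrite /s in a3; lra.
Qed.

(** * Cardinality of the time-sharing variable *)

(** Gaussian elimination, by induction on the number of equations: equation [k0] is either void on
    [A] or has a pivot [q0], which is eliminated from the other equations and removed from [A]. *)
Lemma homogeneous_system_solution (Q K : finType) (D : {set K}) (L : K -> Q -> R) (A : {set Q}) :
  (#|D| < #|A|)%N ->
  exists v : Q -> R, (exists q, v q <> 0) /\ (forall q, q \notin A -> v q = 0) /\
    forall k, k \in D -> \big[Rplus/0]_q (v q * L k q) = 0.
Proof.
have [m] := ubnP #|D|; elim: m D L A => // m IH D L A; rewrite ltnS => Dm DA.
have [k0 /= k0D|D0] := pickP (mem D); last first.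
  have /card_gt0P[q0 q0A] : (0 < #|A|)%N by apply: leq_trans DA.
  exists (fun q => if q == q0 then 1 else 0); split; first by exists q0; rewrite eqxx; lra.
  split=> [q|k]; last by have := D0 k; rewrite /= => ->.
  by case: eqP => // -> /negP.
have Dk : (#|D :\ k0| < m)%N by move: Dm; rewrite (cardsD1 k0 D) k0D.
have [q0 /andP[q0A Lq0]|L0] := pickP (fun q => (q \in A) && ~~ (L k0 q == 0)); last first.
  have [|v [v0 [vA vL]]] := IH (D :\ k0) L A Dk.
    by apply: leq_trans DA; rewrite (cardsD1 k0 D) k0D ltnS leqnSn.
  exists v; split=> //; split=> // k kD; case: (eqVneq k k0) => [->|kk]; last first.
    by apply: vL; rewrite !inE kk.
  rewrite big1 // => q _; case qA: (q \in A); last by rewrite vA ?qA //; lra.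
  by have := L0 q; rewrite qA /= => /negbFE /eqP ->; lra.
have {}Lq0 : L k0 q0 <> 0 by apply/eqP.
have [|v [[q1 v0] [vA vL]]] :=
    IH (D :\ k0) (fun k q => L k q - L k q0 / L k0 q0 * L k0 q) (A :\ q0) Dk.
  by move: DA; rewrite (cardsD1 k0 D) k0D (cardsD1 q0 A) q0A.
(* The value at the pivot that makes equation [k0] hold. *)
pose c := - (\big[Rplus/0]_q (v q * L k0 q)) / L k0 q0.
have vq0 : v q0 = 0 by apply: vA; rewrite !inE eqxx.
have sumE k : \big[Rplus/0]_q ((v q + if q == q0 then c else 0) * L k q) =
    \big[Rplus/0]_q (v q * L k q) + c * L k q0.
  have -> : c * L k q0 = \big[Rplus/0]_q (if q == q0 then c * L k q else 0).
    by rewrite -big_mkcond big_pred1_eq.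
  by rewrite -big_split; apply: eq_bigr => q _ /=; case: ifP => _; ring.
exists (fun q => v q + if q == q0 then c else 0); split.
  exists q1; case: eqP => [e|_]; last lra.
  by rewrite e in v0.
split=> [q qA|k kD].
  rewrite vA ?inE ?(negbTE qA) ?andbF //; case: eqP => [e|_]; last lra.
  by rewrite e q0A in qA.
rewrite sumE; case: (eqVneq k k0) => [->|kk]; first by
  rewrite /c; move: (L k0 q0) Lq0 (bigop _ _ _) => l l0 s; field.
have /vL : k \in D :\ k0 by rewrite !inE kk.
have -> : \big[Rplus/0]_q (v q * (L k q - L k q0 / L k0 q0 * L k0 q)) =
   \big[Rplus/0]_q (v q * L k q) - \big[Rplus/0]_q (v q * L k0 q) * (L k q0 / L k0 q0).
  by rewrite big_distrl -sumRB; apply: eq_bigr => q _ /=; ring.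
by move=> h; rewrite -[RHS]h /c; move: (L k0 q0) Lq0 (\big[Rplus/0]_q (v q * L k0 q)) => l l0 s; field.
Qed.

Lemma exists_min (Q : finType) (A : {set Q}) (f : Q -> R) q1 : q1 \in A ->
  exists q0, q0 \in A /\ forall q, q \in A -> f q0 <= f q.
Proof.
move=> q1A; have := @extremumP _ _ (fun x y : R => Rle_dec x y : bool) q1 (mem A) f.
case=> //.
- by move=> x; case: Rle_dec => //= h; case: h; lra.
- by move=> y x z; do ! case: Rle_dec => //=; lra.
- by move=> x y; do ! case: Rle_dec => //=; lra.
- move=> q0 q0A h; exists q0; split=> // q /h; by case: Rle_dec.
Qed.

Definition positives (Q : finType) (r : Q -> R) : {set Q} := [set q | is_left (Rlt_dec 0 (r q))].

Lemma positivesP (Q : finType) (r : Q -> R) q : reflect (0 < r q) (q \in positives r).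
Proof. by rewrite inE; case: Rlt_dec => h; constructor. Qed.

(* One step moves the weights along a null direction of the constraints, chosen so that the
   linear functional [F] does not decrease, until a weight vanishes. Keeping [F] out of the
   list of constraints is what saves one point over a plain Caratheodory reduction. *)
Lemma support_reduction (Q K : finType) (L : K -> Q -> R) (F lam : Q -> R) (r : Q -> R) :
  (forall q, 0 <= r q) -> (forall q, 0 < r q -> 0 < lam q) ->
  (forall v : Q -> R, (forall k, \big[Rplus/0]_q (v q * L k q) = 0) ->
     \big[Rplus/0]_q (v q * lam q) = 0) ->
  exists r' : Q -> R, (forall q, 0 <= r' q) /\
    (forall k, \big[Rplus/0]_q (r' q * L k q) = \big[Rplus/0]_q (r q * L k q)) /\
    \big[Rplus/0]_q (r q * F q) <= \big[Rplus/0]_q (r' q * F q) /\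
    (#|positives r'| <= #|K|)%N.
Proof.
move=> r0 rl Llam; have [m] := ubnP #|positives r|; elim: m r r0 rl => // m IH r r0 rl; rewrite ltnS => rm.
have [small|big] := leqP #|positives r| #|K|.
  by exists r; split=> //; split=> //; split=> //; apply: Rle_refl.
have [v [[q1 v1] [vA vL]]] : exists v : Q -> R, (exists q, v q <> 0) /\
    (forall q, q \notin positives r -> v q = 0) /\
    forall k, \big[Rplus/0]_q (v q * L k q) = 0.
  have [|v [v0 [vA vL]]] := @homogeneous_system_solution Q K [set: K] L (positives r).
    by rewrite cardsT.
  by exists v; split=> //; split=> // k; apply: vL; rewrite inE.
wlog vF : v v1 vA vL / 0 <= \big[Rplus/0]_q (v q * F q).
  move=> W; case: (Rle_lt_dec 0 (\big[Rplus/0]_q (v q * F q))) => h; first exact: W h.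
  have Nv (G : Q -> R) : \big[Rplus/0]_q (- v q * G q) = - \big[Rplus/0]_q (v q * G q).
    by rewrite -sumRN; apply: eq_bigr => q _; ring.
  apply: (W (fun q => - v q)); rewrite ?Nv; try lra.
  - by move=> q /vA ->; lra.
  - by move=> k; rewrite Nv vL; lra.
have pos q : q \in positives r -> 0 < r q by move/positivesP.
pose neg := positives (fun q => - v q).
have negP' q : reflect (v q < 0) (q \in neg) by apply: (iffP (positivesP _ _)); lra.
(* Without a negative entry, a nonzero [v] would have a positive sum against [lam], which null
   directions exclude. *)
have [q2 q2n] : exists q, q \in neg.
  have [q qn|none] := pickP (mem neg); first by exists q.
  have v0 q : 0 <= v q by apply: Rnot_lt_le => h; have := none q; rewrite /= => /negP; apply; apply/negP'.
  have q1s : q1 \in positives r by apply/negPn/negP => /vA.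
  have : 0 < \big[Rplus/0]_q (v q * lam q).
    apply: (Rlt_le_trans _ (v q1 * lam q1)).
      by apply: Rmult_lt_0_compat; [have := v0 q1; lra | apply: rl; apply: pos].
    apply: (@sumR_ge_term _ xpredT (fun q => v q * lam q)) => // q _.
    case qs: (q \in positives r); last by rewrite vA ?qs //; lra.
    by apply: Rmult_le_pos => //; apply/Rlt_le/rl/pos.
  by rewrite Llam //; lra.
have [q3 [q3n q3m]] := exists_min (fun q => r q / - v q) q2n.
(* The largest step that keeps all weights nonnegative; the weight at [q3] becomes 0. *)
pose th := r q3 / - v q3.
have v3 : v q3 < 0 by apply/negP'.
have th0 : 0 <= th by apply: Rmult_le_pos => //; apply/Rlt_le/Rinv_0_lt_compat; lra.
pose r' q := r q + th * v q.
have sumE (G : Q -> R) : \big[Rplus/0]_q (r' q * G q) =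
    \big[Rplus/0]_q (r q * G q) + th * \big[Rplus/0]_q (v q * G q).
  by rewrite big_distrr -big_split; apply: eq_bigr => q _ /=; rewrite /r'; ring.
have r'0 q : 0 <= r' q.
  case: (Rle_lt_dec 0 (v q)) => h; first by apply: Rplus_le_le_0_compat => //; apply: Rmult_le_pos.
  have /q3m : q \in neg by apply/negP'.
  rewrite -/th => /(Rmult_le_compat_r (- v q) _ _ _); rewrite /r'.
  have -> : r q / - v q * - v q = r q by field; lra.
  by move=> le; have := le _; lra.
have sub : positives r' \proper positives r.
  apply/properP; split; last first.
    exists q3; last first.
      apply/positivesP; have -> : r' q3 = 0 by rewrite /r' /th; field; lra.
      exact: Rlt_irrefl.
    by apply/negPn/negP => /vA; lra.
  apply/subsetP => q q'; apply/negPn/negP => qn.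
  by move: q' => /positivesP; rewrite /r' vA // Rmult_0_r Rplus_0_r => /positivesP; apply/negP.
have [q qp||r'' [r''0 [r''L [r''F r''m]]]] := IH r' r'0.
- apply: rl; apply: pos; move/proper_sub/subsetP: sub; by apply; apply/positivesP.
- exact: leq_trans (proper_card sub) rm.
exists r''; split=> //; split; last split=> //.
  by move=> k; rewrite r''L sumE vL; lra.
apply: Rle_trans r''F; rewrite sumE; nra.
Qed.

(** * Linearity of information in the slice weights *)

Section Weighted.
Variables (T Q : finType) (P : T -> R) (pi : T -> Q).
Hypothesis P0 : forall t, 0 <= P t.

Definition ent_slice (S : finType) (g : T -> S) (q : Q) : R :=
  - \big[Rplus/0]_(t | pi t == q) (P t * log2 (marg P g (g t))).

(** As [g] reveals the slice, reweighting multiplies its marginal by [r] and the logarithm splits.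
    The nonlinear term in [r] is the same for all such [g], which is why it disappears from
    [cmi_weighted]. *)
Lemma ent_weighted (S : finType) (g : T -> S) (r : Q -> R) :
  (forall t t', g t = g t' -> pi t = pi t') -> (forall q, 0 <= r q) ->
  ent (fun t => r (pi t) * P t) g =
  \big[Rplus/0]_q (r q * ent_slice g q) - \big[Rplus/0]_t (r (pi t) * P t * log2 (r (pi t))).
Proof.
move=> h r0; rewrite entE; last by move=> t; apply: Rmult_le_pos.
have -> : \big[Rplus/0]_q (r q * ent_slice g q) =
    - \big[Rplus/0]_t (r (pi t) * (P t * log2 (marg P g (g t)))).
  rewrite -sumRN [RHS](partition_big pi xpredT) //=; apply: eq_bigr => q _.
  rewrite /ent_slice -sumRN big_distrr /=; apply: eq_bigr => t /eqP ->; ring.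
rewrite /Rminus -Ropp_plus_distr -big_split; congr (- _); apply: eq_bigr => t _ /=.
have -> : marg (fun t => r (pi t) * P t) g (g t) = r (pi t) * marg P g (g t).
  by rewrite /marg big_distrr /=; apply: eq_bigr => t' /eqP /h ->.
have [Pt|<-] := Rle_lt_or_eq_dec _ _ (P0 t); last lra.
have [rt|<-] := Rle_lt_or_eq_dec _ _ (r0 (pi t)); last lra.
by rewrite log2_mul //; [ring | exact: marg_gt0].
Qed.

Definition cmi_slice (A B C : finType) (a : T -> A) (b : T -> B) (c : T -> C) (q : Q) : R :=
  ent_slice (fun t => (a t, c t)) q + ent_slice (fun t => (b t, c t)) q
  - ent_slice (fun t => (a t, b t, c t)) q - ent_slice c q.

Lemma cmi_weighted (A B C : finType) (a : T -> A) (b : T -> B) (c : T -> C) (r : Q -> R) :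
  (forall t t', c t = c t' -> pi t = pi t') -> (forall q, 0 <= r q) ->
  cmi (fun t => r (pi t) * P t) a b c = \big[Rplus/0]_q (r q * cmi_slice a b c q).
Proof.
move=> h r0; rewrite /cmi !ent_weighted //; try by move=> t t' [] *; apply: h.
have -> : \big[Rplus/0]_q (r q * cmi_slice a b c q) =
    \big[Rplus/0]_q (r q * ent_slice (fun t => (a t, c t)) q)
    + \big[Rplus/0]_q (r q * ent_slice (fun t => (b t, c t)) q)
    - \big[Rplus/0]_q (r q * ent_slice (fun t => (a t, b t, c t)) q)
    - \big[Rplus/0]_q (r q * ent_slice c q).
  by rewrite -big_split -!sumRB; apply: eq_bigr => q _ /=; rewrite /cmi_slice; ring.
ring.
Qed.

Lemma cmi_slice_null (A B C : finType) (a : T -> A) (b : T -> B) (c : T -> C) q :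
  (forall t, pi t = q -> P t = 0) -> cmi_slice a b c q = 0.
Proof.
move=> h; have z (S : finType) (g : T -> S) : ent_slice g q = 0.
  by rewrite /ent_slice big1 ?Ropp_0 // => t /eqP /h ->; rewrite Rmult_0_l.
by rewrite /cmi_slice !z; lra.
Qed.

End Weighted.

Lemma cmi_relabel (T A B C C' : finType) (P : T -> R) (a : T -> A) (b : T -> B) (c : T -> C)
    (c' : T -> C') :
  (forall t, 0 <= P t) -> (forall t t', (c t == c t') = (c' t == c' t')) ->
  cmi P a b c = cmi P a b c'.
Proof.
move=> P0 h; rewrite /cmi; congr (_ + _ - _ - _); apply: eq_ent => // t t'; by rewrite ?xpair_eqE ?h.
Qed.

(** * Shrinking the alphabet of Q *)

Section Cardinality.
Variables (X1 X2 Y U Q : finType) (W : X1 -> X2 -> Y -> R).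
Variables (px : X1 * X2 -> R) (pu : Y -> U -> R) (pq : X1 -> X2 -> Q -> R).
Hypotheses (Wp : channel W) (pxp : pmf px) (pup : forall y, pmf (pu y))
  (pqp : forall x1 x2, pmf (pq x1 x2)).

Lemma joint_ge0 o : 0 <= joint W px pq pu o.
Proof.
case: o => [[[[x1 x2] q] y] u] /=.
have [h1 _] := pxp; have [h2 _] := pqp x1 x2; have [h3 _] := Wp x1 x2; have [h4 _] := pup y.
by do ! apply: Rmult_le_pos.
Qed.

Notation J := (joint W px pq pu).
Notation slice a b c := (cmi_slice J (@pQ X1 X2 Y Q U) a b c).

(** The condition on [r] says that the reweighted law still has input marginal [px], so [px] factors
    out and the rest is a conditional law on the support of [r]. *)
Lemma joint_restrict (r : Q -> R) (Q' := {q | q \in positives r}) :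
  (forall q, 0 <= r q) ->
  (forall x, \big[Rplus/0]_q (r q * (px x * pq x.1 x.2 q)) = px x) ->
  exists pq' : X1 -> X2 -> Q' -> R, (forall x1 x2, pmf (pq' x1 x2)) /\
    forall o : X1 * X2 * Q' * Y * U,
      joint W px pq' pu o = r (val (pQ o)) * J (pX12 o, val (pQ o), pY o, pU o).
Proof.
move=> r0 rx; have [q0 q0r|none] := pickP (mem (positives r)); last first.
  have [_] := pxp; rewrite /rsum big1; first by lra.
  move=> x _; rewrite -rx big1 // => q _; have := none q; rewrite /= => /positivesP.
  move=> h; have -> : r q = 0 by have := r0 q; lra.
  by rewrite Rmult_0_l.
pose G (x : X1 * X2) (q : Q') := r (val q) * (px x * pq x.1 x.2 (val q)).
have G0 x q : 0 <= G x q.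
  by have [h _] := pxp; have [h' _] := pqp x.1 x.2; do ! apply: Rmult_le_pos.
have Gx x : rsum (G x) = px x.
  rewrite -[RHS]rx [RHS](bigID (mem (positives r))) /= [X in _ + X]big1 ?Rplus_0_r.
    by rewrite (big_sub _ (fun q => r q * (px x * pq x.1 x.2 q))).
  move=> q /positivesP; have := r0 q => ? ?; have -> : r q = 0 by lra.
  by lra.
have [k [kp kE]] := disintegration (exist _ q0 q0r : Q') G0.
exists (fun x1 x2 => k (x1, x2)); split=> // [[[[[x1 x2] q] y] u]].
rewrite /pQ /pX12 /pY /pU /=; have := kE (x1, x2) q; rewrite Gx => ->.
by rewrite /G /=; ring.
Qed.

(** The law on the smaller alphabet is carried by the inclusion [iota] to the reweighted law on the
    full one, where linearity in [r] applies. *)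
Lemma cmi_restrict (r : Q -> R) (Q' := {q | q \in positives r}) (pq' : X1 -> X2 -> Q' -> R)
    (A B C C' : finType) (a : X1 * X2 * Q * Y * U -> A) (b : X1 * X2 * Q * Y * U -> B)
    (c : X1 * X2 * Q * Y * U -> C) (c' : X1 * X2 * Q' * Y * U -> C')
    (iota := fun o : X1 * X2 * Q' * Y * U => (pX12 o, val (pQ o), pY o, pU o)) :
  (forall q, 0 <= r q) ->
  (forall o, joint W px pq' pu o = r (val (pQ o)) * J (iota o)) ->
  (forall t t', c t = c t' -> pQ t = pQ t') ->
  (forall t t', (c (iota t) == c (iota t')) = (c' t == c' t')) ->
  cmi (joint W px pq' pu) (fun t => a (iota t)) (fun t => b (iota t)) c' =
  \big[Rplus/0]_q (r q * slice a b c q).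
Proof.
move=> r0 jE cQ cc.
rewrite -(cmi_weighted joint_ge0) //.
have J0 t : 0 <= joint W px pq' pu t by rewrite jE; apply: Rmult_le_pos => //; apply: joint_ge0.
rewrite -(cmi_relabel _ _ J0 cc).
have -> : (fun t => r (pQ t) * J t) = marg (joint W px pq' pu) iota; last by rewrite cmi_marg.
apply: functional_extensionality => t; apply/esym; rewrite /marg.
case qr: (pQ t \in positives r).
  pose t' : X1 * X2 * Q' * Y * U := (pX12 t, exist _ (pQ t) qr, pY t, pU t).
  have iota_t' : iota t' = t by rewrite /iota /pX12 /pQ /pY /pU /= -!surjective_pairing.
  rewrite (big_pred1 t') => [|s]; first by rewrite jE iota_t'.
  rewrite -{1}iota_t'; case: s => [[[[x1 x2] q] y] u].
  rewrite [RHS]/=; apply/eqP/eqP => [|->] //; rewrite /iota /t' /pX12 /pQ /pY /pU /=.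
  by case=> -> e -> ->; congr (_, _, _, _); apply: val_inj.
rewrite big1 => [|s /eqP e].
  move: qr => /negbT /positivesP; have := r0 (pQ t) => ? ?; have -> : r (pQ t) = 0 by lra.
  by lra.
by move: qr; rewrite -e /pQ /= (valP (pQ s)).
Qed.

(** One constraint per input pair preserves [px], and three more preserve the second, third and
    fourth entries. The first entry is constant, and the fifth is left to the functional that may
    only increase. *)
Lemma diamond_obj_card_le (C1 C2 : R) :
  exists (Q' : finType) (pq' : X1 -> X2 -> Q' -> R),
    (#|Q'| <= #|X1| * #|X2| + 3)%N /\ (forall x1 x2, pmf (pq' x1 x2)) /\
    diamond_obj W C1 C2 px pq pu <= diamond_obj W C1 C2 px pq' pu.
Proof.
pose Fa := slice (@pX2 X1 X2 Y Q U) (@pY X1 X2 Y Q U) (@pX1Q X1 X2 Y Q U).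
pose Fb := slice (@pX1 X1 X2 Y Q U) (@pY X1 X2 Y Q U) (@pX2Q X1 X2 Y Q U).
pose Fc := slice (@pX12 X1 X2 Y Q U) (@pY X1 X2 Y Q U) (@pQ X1 X2 Y Q U).
pose Fd := slice (@pX12 X1 X2 Y Q U) (@pU X1 X2 Y Q U) (@pQ X1 X2 Y Q U).
pose Fe := slice (@pX2 X1 X2 Y Q U) (@pU X1 X2 Y Q U) (@pX1Q X1 X2 Y Q U).
pose Ff := slice (@pX1 X1 X2 Y Q U) (@pU X1 X2 Y Q U) (@pX2Q X1 X2 Y Q U).
pose w (x : X1 * X2) q := px x * pq x.1 x.2 q.
have w0 x q : 0 <= w x q.
  by have [h _] := pxp; have [h' _] := pqp x.1 x.2; apply: Rmult_le_pos.
pose L (k : option (option (option (X1 * X2)))) : Q -> R :=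
  match k with
  | None => Fa | Some None => Fb | Some (Some None) => Fc
  | Some (Some (Some x)) => w x
  end.
pose F q := - Fd q + Fe q + Ff q.
(* The slice mass [lam] is a sum of constraint functions, so null directions preserve total mass
   without an extra constraint. Null slices start with weight 0, which gives positivity of [lam] on
   the support. *)
pose lam q := \big[Rplus/0]_x w x q.
pose r0 q := if Rlt_dec 0 (lam q) then 1 else 0.
have r00 q : 0 <= r0 q by rewrite /r0; case: Rlt_dec => h /=; lra.
have r0lam q : 0 < r0 q -> 0 < lam q by rewrite /r0; case: Rlt_dec => h /=; lra.
have [v hv|r [rr [rL [rF rK]]]] := @support_reduction _ _ L F lam r0 r00 r0lam.
  rewrite /lam; under eq_bigr => q _ do rewrite big_distrr /=.
  by rewrite exchange_big big1 // => x _; apply: (hv (Some (Some (Some x)))).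
have null q x : ~ 0 < lam q -> w x q = 0.
  move=> h; have : w x q <= lam q by apply: (@sumR_ge_term _ xpredT (fun x => w x q)).
  by have := w0 x q; lra.
have Jnull q : ~ 0 < lam q -> forall t, pQ t = q -> J t = 0.
  move=> h [[[[x1 x2] q'] y] u]; rewrite {1}/pQ /= => e; rewrite e.
  by have := null _ (x1, x2) h; rewrite /w /= => ->; rewrite !Rmult_0_l.
have unit_weight (G : Q -> R) : (forall q, ~ 0 < lam q -> G q = 0) ->
    \big[Rplus/0]_q (r0 q * G q) = \big[Rplus/0]_q G q.
  move=> h; apply: eq_bigr => q _; rewrite /r0; case: Rlt_dec => l /=; first lra.
  by rewrite h // Rmult_0_r.
have cmiJ (A B C : finType) (a : _ -> A) (b : _ -> B) (c : _ -> C) :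
    (forall t t', c t = c t' -> pQ t = pQ t') ->
    cmi J a b c = \big[Rplus/0]_q (r0 q * slice a b c q).
  move=> cQ; rewrite unit_weight; last by move=> q /Jnull; apply: cmi_slice_null.
  have := @cmi_weighted _ _ J (@pQ X1 X2 Y Q U) joint_ge0 _ _ _ a b c (fun=> 1) cQ (fun=> Rle_0_1).
  have -> : (fun t => 1 * J t) = J by apply: functional_extensionality => t; rewrite Rmult_1_l.
  by move=> ->; apply: eq_bigr => q _; rewrite Rmult_1_l.
have rx x : \big[Rplus/0]_q (r q * (px x * pq x.1 x.2 q)) = px x.
  rewrite (rL (Some (Some (Some x)))) unit_weight; last by move=> q /null; apply.
  by rewrite -big_distrr /=; have [_] := pqp x.1 x.2; rewrite /rsum => ->; lra.
have [pq' [pqp' jE]] := joint_restrict rr rx.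
exists {q | q \in positives r}, pq'; split; last split=> //.
  rewrite card_sig; apply: leq_trans rK _.
  by rewrite !card_option card_prod addn3.
pose Q' : finType := {q | q \in positives r}; pose J' : X1 * X2 * Q' * Y * U -> R := joint W px pq' pu.
have pQ_det (t t' : X1 * X2 * Q * Y * U) : pQ t = pQ t' -> pQ t = pQ t' by [].
have pX1Q_det (t t' : X1 * X2 * Q * Y * U) : pX1Q t = pX1Q t' -> pQ t = pQ t' by case.
have pX2Q_det (t t' : X1 * X2 * Q * Y * U) : pX2Q t = pX2Q t' -> pQ t = pQ t' by case.
pose iota (o : X1 * X2 * Q' * Y * U) := (pX12 o, val (pQ o), pY o, pU o).
have pQ_eq t t' : (pQ (iota t) == pQ (iota t')) = (pQ t == pQ t') by exact: val_eqE.
have pX1Q_eq t t' : (pX1Q (iota t) == pX1Q (iota t')) = (pX1Q t == pX1Q t').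
  by rewrite !xpair_eqE /= val_eqE.
have pX2Q_eq t t' : (pX2Q (iota t) == pX2Q (iota t')) = (pX2Q t == pX2Q t').
  by rewrite !xpair_eqE /= val_eqE.
have ea : cmi J' (@pX2 X1 X2 Y Q' U) (@pY X1 X2 Y Q' U) (@pX1Q X1 X2 Y Q' U) =
    \big[Rplus/0]_q (r q * Fa q).
  exact: (cmi_restrict (@pX2 X1 X2 Y Q U) (@pY X1 X2 Y Q U) rr jE pX1Q_det pX1Q_eq).
have eb : cmi J' (@pX1 X1 X2 Y Q' U) (@pY X1 X2 Y Q' U) (@pX2Q X1 X2 Y Q' U) =
    \big[Rplus/0]_q (r q * Fb q).
  exact: (cmi_restrict (@pX1 X1 X2 Y Q U) (@pY X1 X2 Y Q U) rr jE pX2Q_det pX2Q_eq).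
have ec : cmi J' (@pX12 X1 X2 Y Q' U) (@pY X1 X2 Y Q' U) (@pQ X1 X2 Y Q' U) =
    \big[Rplus/0]_q (r q * Fc q).
  exact: (cmi_restrict (@pX12 X1 X2 Y Q U) (@pY X1 X2 Y Q U) rr jE pQ_det pQ_eq).
have ed : cmi J' (@pX12 X1 X2 Y Q' U) (@pU X1 X2 Y Q' U) (@pQ X1 X2 Y Q' U) =
    \big[Rplus/0]_q (r q * Fd q).
  exact: (cmi_restrict (@pX12 X1 X2 Y Q U) (@pU X1 X2 Y Q U) rr jE pQ_det pQ_eq).
have ee : cmi J' (@pX2 X1 X2 Y Q' U) (@pU X1 X2 Y Q' U) (@pX1Q X1 X2 Y Q' U) =
    \big[Rplus/0]_q (r q * Fe q).
  exact: (cmi_restrict (@pX2 X1 X2 Y Q U) (@pU X1 X2 Y Q U) rr jE pX1Q_det pX1Q_eq).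
have ef : cmi J' (@pX1 X1 X2 Y Q' U) (@pU X1 X2 Y Q' U) (@pX2Q X1 X2 Y Q' U) =
    \big[Rplus/0]_q (r q * Ff q).
  exact: (cmi_restrict (@pX1 X1 X2 Y Q U) (@pU X1 X2 Y Q U) rr jE pX2Q_det pX2Q_eq).
rewrite /diamond_obj -/J' ea eb ec ed ee ef !cmiJ //.
rewrite -(rL None) -(rL (Some None)) -(rL (Some (Some None))).
do 4 apply: Rle_min_compat_l.
have sumF (s : Q -> R) : \big[Rplus/0]_q (s q * F q) = \big[Rplus/0]_q (s q * Fe q)
    + \big[Rplus/0]_q (s q * Ff q) - \big[Rplus/0]_q (s q * Fd q).
  by rewrite -big_split -sumRB; apply: eq_bigr => q _ /=; rewrite /F; ring.
move: rF; rewrite !sumF /L.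
rewrite -/Fd -/Fe -/Ff.
Show.
lra.
Qed.

End Cardinality.

Theorem theorem3 (X1 X2 Y : finType) (W : X1 -> X2 -> Y -> R) (C1 C2 : R) :
  0 <= C1 -> 0 <= C2 -> channel W ->
  (* C^diamond <= sup_{p(x1,x2)} inf_{U, p(u|y)} sup_{Q, p(q|x1,x2)} obj *)
  (forall Rt : R, achievable W C1 C2 Rt ->
     forall eps : R, 0 < eps ->
     exists px : X1 * X2 -> R, pmf px /\
       forall (U : finType) (pu : Y -> U -> R), (forall y, pmf (pu y)) ->
       exists (Q : finType) (pq : X1 -> X2 -> Q -> R),
         (forall x1 x2, pmf (pq x1 x2)) /\
         Rt - eps <= diamond_obj W C1 C2 px pq pu)
  /\
  (* the inner sup over all finite Q equals the sup over |Q| <= |X1||X2|+3 *)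
  (forall (px : X1 * X2 -> R) (U : finType) (pu : Y -> U -> R)
          (Q : finType) (pq : X1 -> X2 -> Q -> R),
     pmf px -> (forall y, pmf (pu y)) -> (forall x1 x2, pmf (pq x1 x2)) ->
     forall eps : R, 0 < eps ->
     exists (Q' : finType) (pq' : X1 -> X2 -> Q' -> R),
       (#|Q'| <= #|X1| * #|X2| + 3)%N /\
       (forall x1 x2, pmf (pq' x1 x2)) /\
       diamond_obj W C1 C2 px pq pu - eps <= diamond_obj W C1 C2 px pq' pu).
Proof.
move=> _ _ Wp; split; first by move=> Rt; apply: diamond_converse.
move=> px U pu Q pq pxp pup pqp eps e0.
have [Q' [pq' [cQ [pqp' le]]]] := diamond_obj_card_le Wp pxp pup pqp C1 C2.
by exists Q', pq'; split=> //; split=> //; lra.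
Qed.
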